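(* Let $A$ be a unital separable $C^*$-algebra which is a quotient generator (every separable $C^*$-algebra is $*$-isomorphic to $A/K$ for some closed two-sided ideal $K$ of $A$). Equip $\mathrm{Ideal}(A)$ with the Wijsman topology. There is a Borel map \[ \kappa_{K_1}:\mathrm{Ideal}(A)\to\mathrm{Sub}(\mathbb{Z}^{(\mathbb{N})}) \] such that $\mathbb{Z}^{(\mathbb{N})}/\kappa_{K_1}(K)\cong K_1(A/K)$ for every $K\in\mathrm{Ideal}(A)$.
   Context: $\mathrm{Ideal}(A)$ denotes the set of closed two-sided ideals of $A$. The Wijsman topology on $\mathrm{Ideal}(A)$ is the coarsest topology making each map $K\mapsto d(x,K)=\inf_{y\in K}\|x-y\|$ continuous, for every fixed $x\in A$. $\mathbb{Z}^{(\mathbb{N})}=\bigoplus_{n\in\mathbb{N}}\mathbb{Z}e_n$ and $\mathrm{Sub}(\mathbb{Z}^{(\mathbb{N})})$ is the set of its subgroups, a closed subset of $2^{\mathbb{Z}^{(\mathbb{N})}}$ with the product topology.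
   Formalization: ''Quotient generator'' is taken to mean that every unital separable C*-algebra is *-isomorphic to some A/K; with all separable C*-algebras no unital A qualifies, since every quotient of a unital algebra is unital while, for example, c_0 is not. *)

(* Defs.v *)
From HB Require Import structures.
From mathcomp Require Import all_boot all_order all_algebra ring_quotient.
From mathcomp Require Import complex.
From mathcomp Require Import all_classical reals topology normedtype.
From mathcomp Require Import measurable_structure.
From mathcomp Require Import freeg.

Set Implicit Arguments.
Unset Strict Implicit.
Unset Printing Implicit Defensive.

Import Order.TTheory GRing.Theory Num.Theory.
Import numFieldNormedType.Exports.

Local Open Scope classical_set_scope.
Local Open Scope ring_scope.
Local Open Scope complex_scope.
Local Open Scope quotient_scope.

(* An algebra structure on top of normedModType.  The library's algType is not
   used because it requires 1 != 0, while the quotient of an algebra by itself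
   is the zero algebra; the ring structure is derived below, as a join of
   pzRingType and normedModType cannot be declared as a structure. *)
HB.mixin Record isUnitalNormedAlgebra (R : realType) A
    of NormedModule R[i] A := {
  nalg_one : A;
  nalg_mul : A -> A -> A;
  nalg_mulA : associative nalg_mul;
  nalg_mul1 : left_id nalg_one nalg_mul;
  nalg_mulr1 : right_id nalg_one nalg_mul;
  nalg_mulDl : left_distributive nalg_mul +%R;
  nalg_mulDr : right_distributive nalg_mul +%R;
  nalg_scaleAl : forall (c : R[i]) (x y : A),
    c *: nalg_mul x y = nalg_mul (c *: x) y;
  nalg_scaleAr : forall (c : R[i]) (x y : A),
    c *: nalg_mul x y = nalg_mul x (c *: y);
  nalg_normM : forall x y : A, `|nalg_mul x y| <= `|x| * `|y|
}.

#[short(type="normedAlgType")]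
HB.structure Definition UnitalNormedAlgebra (R : realType) :=
  {A of NormedModule R[i] A & isUnitalNormedAlgebra R A}.

HB.instance Definition _ (R : realType) (A : normedAlgType R) :=
  GRing.Zmodule_isPzRing.Build A (@nalg_mulA R A) (@nalg_mul1 R A)
    (@nalg_mulr1 R A) (@nalg_mulDl R A) (@nalg_mulDr R A).

HB.mixin Record isUnitalCstarAlgebra (R : realType) A
    of UnitalNormedAlgebra R A & Complete A := {
  star : A -> A;
  starK : involutive star;
  starD : {morph star : x y / x + y};
  starZ : forall (c : R[i]) (x : A), star (c *: x) = c^* *: star x;
  starM : forall x y : A, star (nalg_mul x y) = nalg_mul (star y) (star x);
  cstar_identity : forall x : A, `|nalg_mul (star x) x| = `|x| ^+ 2
}.

#[short(type="cstarAlgType")]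
HB.structure Definition UnitalCstarAlgebra (R : realType) :=
  {A of UnitalNormedAlgebra R A & Complete A & isUnitalCstarAlgebra R A}.

HB.instance Definition _ (R : realType) (A : cstarAlgType R) :=
  GRing.PzRing.copy (A : Type) (UnitalNormedAlgebra.sort A).

Definition separable_space (T : topologicalType) : Prop :=
  exists2 D : set T, countable D & dense D.

(* The norm of a normed module over R[i] takes its values in R[i]. *)
Definition rnorm (R : realType) (A : normedModType R[i]) (x : A) : R :=
  complex.Re `|x|.

Definition dist (R : realType) (A : normedModType R[i]) (x : A) (K : set A) : R :=
  inf [set rnorm (x - y) | y in K].

Record closed_ideal (R : realType) (A : normedAlgType R) := ClosedIdeal {
  ideal_set :> set A;
  ideal_closed : closed ideal_set;
  ideal0 : ideal_set 0;
  idealD : forall x y, ideal_set x -> ideal_set y -> ideal_set (x + y);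
  idealZ : forall (c : R[i]) x, ideal_set x -> ideal_set (c *: x);
  idealMl : forall a x, ideal_set x -> ideal_set (a * x);
  idealMr : forall a x, ideal_set x -> ideal_set (x * a)
}.

HB.instance Definition _ (R : realType) (A : normedAlgType R) :=
  gen_eqMixin (closed_ideal A).
HB.instance Definition _ (R : realType) (A : normedAlgType R) :=
  gen_choiceMixin (closed_ideal A).

(* The Wijsman topology: the supremum, over x, of the initial topologies of the
   maps K |-> dist x K. *)
HB.instance Definition _ (R : realType) (A : normedAlgType R) :=
  Topological.copy (closed_ideal A)
    (sup_topology (fun x : A => Topological.class
      (initial_topology (fun K : closed_ideal A => dist x K)))).

Section Quotient_algebra.
Context (R : realType) (A : normedAlgType R) (K : closed_ideal A).

Definition ideal_pred : {pred A} := fun x => `[< ideal_set K x >].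

Fact ideal_pred_zmod_closed : zmod_closed ideal_pred.
Proof.
split; first by apply/asboolP; exact: ideal0.
move=> x y /asboolP Kx /asboolP Ky; apply/asboolP.
by rewrite -scaleN1r; apply: idealD => //; exact: idealZ.
Qed.

HB.instance Definition _ :=
  GRing.isZmodClosed.Build A ideal_pred ideal_pred_zmod_closed.

Definition quot_alg : Type := Quotient.quot ideal_pred.

HB.instance Definition _ := GRing.Zmodule.on quot_alg.
HB.instance Definition _ : EqQuotient A (Quotient.equiv ideal_pred) quot_alg :=
  EqQuotient.on quot_alg.
HB.instance Definition _ :=
  @isZmodQuotient.Build A (Quotient.equiv ideal_pred) 0 -%R +%R quot_alg
  (@pi_zeror _ _ _ _ _ (Quotient.quot ideal_pred))
  (@pi_oppr _ _ _ _ _ (Quotient.quot ideal_pred))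
  (@pi_addr _ _ _ _ _ (Quotient.quot ideal_pred)).

Definition qpi (x : A) : quot_alg := \pi_quot_alg x.

Lemma qpiP (x y : A) : qpi x = qpi y <-> ideal_set K (x - y).
Proof.
split=> [/eqP|/asboolP Kxy]; first by rewrite piE => /asboolP.
by apply/eqP; rewrite piE.
Qed.

Lemma reprqK (q : quot_alg) : qpi (repr q) = q.
Proof. exact: reprK. Qed.

Lemma repr_qpi (x : A) : ideal_set K (x - repr (qpi x)).
Proof. by apply/qpiP; rewrite reprqK. Qed.

Lemma qpiD x y : qpi (x + y) = qpi x + qpi y.
Proof. exact: (@pi_addr _ _ _ _ _ quot_alg). Qed.

Lemma qpiN x : qpi (- x) = - qpi x.
Proof. exact: (@pi_oppr _ _ _ _ _ quot_alg). Qed.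

Lemma qpi0 : qpi 0 = 0.
Proof. exact: (@pi_zeror _ _ _ _ _ quot_alg). Qed.

Definition qone : quot_alg := qpi 1.
Definition qmul (p q : quot_alg) : quot_alg := qpi (repr p * repr q).
Definition qscale (c : R[i]) (q : quot_alg) : quot_alg := qpi (c *: repr q).

Lemma qpiM x y : qpi (x * y) = qmul (qpi x) (qpi y).
Proof.
apply/qpiP; set x' := repr _; set y' := repr _.
have -> : x * y - x' * y' = (x - x') * y + x' * (y - y').
  by rewrite mulrBl mulrBr addrA subrK.
apply: idealD; first by apply: idealMr; exact: repr_qpi.
by apply: idealMl; exact: repr_qpi.
Qed.

Lemma qpiZ c x : qpi (c *: x) = qscale c (qpi x).
Proof. by apply/qpiP; rewrite -scalerBr; apply: idealZ; exact: repr_qpi. Qed.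

Fact qscaleA a b q : qscale a (qscale b q) = qscale (a * b) q.
Proof. by rewrite -(reprqK q) -!qpiZ scalerA. Qed.

Fact qscale1 : left_id 1 qscale.
Proof. by move=> q; rewrite -(reprqK q) -!qpiZ scale1r. Qed.

Fact qscaleDr : right_distributive qscale +%R.
Proof.
by move=> c p q; rewrite -(reprqK p) -(reprqK q) -!(qpiZ, qpiD) scalerDr.
Qed.

Fact qscaleDl q : {morph qscale^~ q : a b / a + b}.
Proof. by move=> a b; rewrite -(reprqK q) -!(qpiZ, qpiD) scalerDl. Qed.

HB.instance Definition _ := GRing.Zmodule_isLmodule.Build R[i] quot_alg
  qscaleA qscale1 qscaleDr qscaleDl.

Lemma rnorm_ge0 (x : A) : 0 <= rnorm x.
Proof. by rewrite /rnorm -ler0c RRe_real ?normr_real. Qed.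

Lemma rnormE (x : A) : (rnorm x)%:C = `|x|.
Proof. by rewrite /rnorm RRe_real ?normr_real. Qed.

Lemma rnormD (x y : A) : rnorm (x + y) <= rnorm x + rnorm y.
Proof. by rewrite -lecR [leRHS]rmorphD/= !rnormE ler_normD. Qed.

(* The quotient norm: the infimum of the norms of the representatives. *)
Definition qnormR (q : quot_alg) : R := inf [set rnorm x | x in [set x | qpi x = q]].
Definition qnorm (q : quot_alg) : R[i] := (qnormR q)%:C.

Lemma qnormR_has_inf q : has_inf [set rnorm x | x in [set x | qpi x = q]].
Proof.
split; first by exists (rnorm (repr q)); exists (repr q) => //=; exact: reprqK.
by exists 0 => _ [x _ <-]; exact: rnorm_ge0.
Qed.

Lemma qnormR_le x : qnormR (qpi x) <= rnorm x.
Proof. by apply: ge_inf; [case: (qnormR_has_inf (qpi x)) | exists x]. Qed.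

Lemma qnormR_adh q (e : R) : 0 < e ->
  exists2 x, qpi x = q & rnorm x < qnormR q + e.
Proof.
by move=> /inf_adherent /(_ (qnormR_has_inf q)) [_ [x qx <-] lt]; exists x.
Qed.

Lemma qnormR_ge0 q : 0 <= qnormR q.
Proof.
apply: lb_le_inf; first by case: (qnormR_has_inf q).
by move=> _ [x _ <-]; exact: rnorm_ge0.
Qed.

Lemma qnormR_dist x : qnormR (qpi x) = dist x K.
Proof.
congr inf; apply/seteqP; split=> _ [y yP <-].
  exists (x - y); last by rewrite opprB addrC subrK.
  by apply/qpiP; rewrite yP.
exists (x - y) => //=; apply/qpiP.
by rewrite addrAC subrr sub0r -scaleN1r; exact: idealZ.
Qed.

Fact qnormD p q : qnorm (p + q) <= qnorm p + qnorm q.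
Proof.
rewrite /qnorm -rmorphD lecR; apply/ler_addgt0Pr => e e0.
have e20 : 0 < e / 2 by rewrite divr_gt0.
have [x xp ltx] := qnormR_adh p e20; have [y yq lty] := qnormR_adh q e20.
rewrite -xp -yq -qpiD; apply: le_trans (qnormR_le _) _; rewrite xp yq.
rewrite [e]splitr addrACA; apply: le_trans (rnormD _ _) _.
by rewrite lerD// ltW.
Qed.

Lemma qnormZ_le c q : qnorm (c *: q) <= `|c| * qnorm q.
Proof.
have -> : `|c| = (complex.Re `|c|)%:C by rewrite RRe_real ?normr_real.
have c0 : 0 <= complex.Re `|c| by rewrite -ler0c RRe_real ?normr_real.
rewrite /qnorm -rmorphM lecR; apply/ler_addgt0Pr => e e0.
set r := complex.Re _ in c0 *.
have d0 : 0 < e / (r + 1) by rewrite divr_gt0// ltr_wpDl.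
have [x xq ltx] := qnormR_adh q d0.
have -> : c *: q = qpi (c *: x) by rewrite qpiZ xq.
apply: le_trans (qnormR_le _) _.
have -> : rnorm (c *: x) = r * rnorm x.
  apply: complexI; rewrite rnormE rmorphM/= rnormE normrZ.
  by rewrite /r RRe_real ?normr_real.
apply: le_trans (ler_wpM2l c0 (ltW ltx)) _.
rewrite mulrDr lerD2l mulrA ler_pdivrMr ?ltr_wpDl// mulrC ler_pM2l//.
by rewrite lerDl.
Qed.

Fact qnormZ c q : qnorm (c *: q) = `|c| * qnorm q.
Proof.
apply/eqP; rewrite eq_le qnormZ_le/=.
have [->|c0] := eqVneq c 0.
  by rewrite normr0 mul0r ler0c qnormR_ge0.
have /(ler_wpM2l (normr_ge0 c)) := qnormZ_le c^-1 (c *: q).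
by rewrite scalerA mulVf// scale1r mulrA -normrM mulfV// normr1 mul1r.
Qed.

Fact qnorm0_eq0 q : qnorm q = 0 -> q = 0.
Proof.
move=> /complexI q0; rewrite -(reprqK q) -qpi0; apply/qpiP; rewrite subr0.
apply: (@ideal_closed _ _ K) => B /nbhs_ballP[e /= e0 eB].
have e'0 : 0 < complex.Re e by move: e0; rewrite ltcE => /andP[].
have [x xq] := qnormR_adh q e'0; rewrite q0 add0r => ltx.
exists (repr q - x); split; first by apply/qpiP; rewrite reprqK xq.
apply: eB; rewrite -ball_normE /ball_/= opprB addrC subrK.
rewrite -rnormE; suff -> : e = (complex.Re e)%:C by rewrite ltcR.
by rewrite RRe_real// gtr0_real.
Qed.

HB.instance Definition _ :=
  Lmodule_isNormed.Build R[i] quot_alg qnormD qnormZ qnorm0_eq0.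

Fact qmulA : associative qmul.
Proof.
move=> p q r; rewrite -(reprqK p) -(reprqK q) -(reprqK r).
by rewrite -!qpiM mulrA.
Qed.

Fact qmul1 : left_id qone qmul.
Proof. by move=> q; rewrite -(reprqK q) -qpiM mul1r. Qed.

Fact qmulr1 : right_id qone qmul.
Proof. by move=> q; rewrite -(reprqK q) -qpiM mulr1. Qed.

Fact qmulDl : left_distributive qmul +%R.
Proof.
move=> p q r; rewrite -(reprqK p) -(reprqK q) -(reprqK r).
by rewrite -!(qpiM, qpiD) mulrDl.
Qed.

Fact qmulDr : right_distributive qmul +%R.
Proof.
move=> p q r; rewrite -(reprqK p) -(reprqK q) -(reprqK r).
by rewrite -!(qpiM, qpiD) mulrDr.
Qed.

Fact qscaleAl (c : R[i]) p q : c *: qmul p q = qmul (c *: p) q.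
Proof.
rewrite -(reprqK p) -(reprqK q) -qpiM -[LHS]qpiZ.
by rewrite -[c *: _]qpiZ -qpiM [c *: _]nalg_scaleAl.
Qed.

Fact qscaleAr (c : R[i]) p q : c *: qmul p q = qmul p (c *: q).
Proof.
rewrite -(reprqK p) -(reprqK q) -qpiM -[LHS]qpiZ.
by rewrite -[c *: _]qpiZ -qpiM [c *: _]nalg_scaleAr.
Qed.

Fact qnormM p q : `|qmul p q| <= `|p| * `|q|.
Proof.
rewrite -[`|qmul p q|]/(qnorm _) -[`|p|]/(qnorm _) -[`|q|]/(qnorm _).
rewrite /qnorm -rmorphM lecR; apply/ler_addgt0Pr => e e0.
set s := qnormR p + qnormR q + 1.
have s0 : 0 < s by rewrite ltr_wpDl// addr_ge0// qnormR_ge0.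
pose d := Num.min 1 (e / s).
have d0 : 0 < d by rewrite lt_min ltr01 divr_gt0.
have [x xp ltx] := qnormR_adh p d0; have [y yq lty] := qnormR_adh q d0.
have -> : qmul p q = qpi (x * y) by rewrite qpiM xp yq.
apply: le_trans (qnormR_le _) _.
have : rnorm (x * y) <= rnorm x * rnorm y.
  by rewrite -lecR rmorphM/= !rnormE; exact: nalg_normM.
move/le_trans; apply.
apply: le_trans (ler_pM (rnorm_ge0 _) (rnorm_ge0 _) (ltW ltx) (ltW lty)) _.
have -> : (qnormR p + d) * (qnormR q + d) =
    qnormR p * qnormR q + d * (qnormR p + qnormR q + d).
  by rewrite mulrDl !mulrDr [qnormR p * d]mulrC -!addrA.
rewrite lerD2l; have ds : d * s <= e by rewrite -ler_pdivlMr// ge_min lexx orbT.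
apply: le_trans ds; rewrite ler_wpM2l ?(ltW d0)// lerD2l.
by rewrite ge_min lexx.
Qed.

(* quot_alg is complete as soon as A is, and a C*-algebra when A is one; the
   definitions below only use its normed algebra structure. *)
HB.instance Definition _ := isUnitalNormedAlgebra.Build R quot_alg
  qmulA qmul1 qmulr1 qmulDl qmulDr qscaleAl qscaleAr qnormM.

End Quotient_algebra.

Section Matrix_continuity.
Context (R : realType) (B : normedAlgType R).

Lemma cvg_nalgM (T : Type) (F : set_system T) {FF : Filter F} (f g : T -> B)
    (a b : B) : f @ F --> a -> g @ F --> b -> (fun t => f t * g t) @ F --> a * b.
Proof.
move=> /cvgrPdist_lt fa /cvgrPdist_lt gb; apply/cvgrPdist_le => e e0.
have e20 : 0 < e / 2 by rewrite divr_gt0.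
have b0 : 0 < `|b| + 1 by rewrite ltr_wpDl.
have a0 : 0 < `|a| + 1 by rewrite ltr_wpDl.
have := fa _ (divr_gt0 e20 b0); have := gb _ (divr_gt0 e20 a0).
have := gb 1 ltr01; apply: filterS3 => t g1 gt ft.
have -> : a * b - f t * g t = (a - f t) * g t + a * (b - g t).
  by rewrite mulrBl mulrBr [RHS]addrC addrA subrK.
rewrite [e]splitr; apply: le_trans (ler_normD _ _) _; apply: lerD.
  apply: le_trans (nalg_normM _ _) _.
  have gle : `|g t| <= `|b| + 1.
    have -> : g t = b - (b - g t) by rewrite opprB addrC subrK.
    by apply: le_trans (ler_normB _ _) _; rewrite lerD2l ltW.
  apply: le_trans (ler_pM _ _ (ltW ft) gle) _ => //.
  by rewrite divfK// gt_eqF.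
apply: le_trans (nalg_normM _ _) _.
apply: le_trans (ler_wpM2l _ (ltW gt)) _ => //.
by rewrite mulrCA ler_piMr ?(ltW e20)// ler_pdivrMr// mul1r lerDl.
Qed.

Lemma mx_cvgP (T : Type) (F : set_system T) {FF : Filter F} n
    (f : T -> 'M[B]_n) (a : 'M[B]_n) :
  (f @ F --> a) <-> (forall i j, (fun t => f t i j) @ F --> a i j).
Proof.
split=> [fa i j U aU|fa].
  apply: (fa [set m : 'M[B]_n | U (m i j)]).
  exists (fun k l => if (k == i) && (l == j) then U else setT) => [k l|m /=].
    by case: ifP => [/andP[/eqP-> /eqP->]//|_]; exact: filterT.
  by move=> /(_ i j); rewrite !eqxx.
move=> U [P aP PU]; rewrite /fmap/=.
apply: (@filterS _ F _ [set t | forall ij : 'I_n * 'I_n, P ij.1 ij.2 (f t ij.1 ij.2)]).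
  by move=> t tP; apply: PU => i j; exact: (tP (i, j)).
by apply: filter_forall => -[i j]; exact: fa (aP i j).
Qed.

Lemma mx_cvgM (T : Type) (F : set_system T) {FF : Filter F} n
    (f g : T -> 'M[B]_n) (a b : 'M[B]_n) :
  f @ F --> a -> g @ F --> b -> (fun t => f t *m g t) @ F --> a *m b.
Proof.
move=> /mx_cvgP fa /mx_cvgP gb; apply/mx_cvgP => i j.
have -> : (fun t => (f t *m g t) i j) = (fun t => \sum_k f t i k * g t k j).
  by apply/funext => t; rewrite mxE.
rewrite mxE; elim: (index_enum _) => [|k s IHs].
  rewrite big_nil (_ : (fun t => _) = cst 0); first exact: cvg_cst.
  by apply/funext => t; rewrite big_nil.
rewrite big_cons (_ : (fun t => _) =
  (fun t => f t i k * g t k j + \sum_(k <- s) f t i k * g t k j)).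
  by apply: cvgD => //; exact: cvg_nalgM.
by apply/funext => t; rewrite big_cons.
Qed.

End Matrix_continuity.

Section K1.
Context (R : realType) (B : normedAlgType R).
Implicit Types n m N : nat.

Definition mx_invertible n (a : 'M[B]_n) : Prop :=
  exists b : 'M[B]_n, a *m b = 1%:M /\ b *m a = 1%:M.

(* a and b lie in the same path component of GL_n(B).  The topology of 'M[B]_n
   is that of entrywise convergence. *)
Definition gl_homotopic n (a b : 'M[B]_n) : Prop :=
  exists gamma : R -> 'M[B]_n,
    [/\ {within `[0, 1], continuous gamma},
        (forall t, 0 <= t <= 1 -> mx_invertible (gamma t)),
        gamma 0 = a & gamma 1 = b].

(* The upper left n x n block is a, and the other entries are those of the
   identity matrix; thus stab N a = diag(a, 1) when n <= N, the only case in
   which it is used. *)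
Definition stab n N (a : 'M[B]_n) : 'M[B]_N :=
  \matrix_(i, j) match insub (val i), insub (val j) with
                 | Some i', Some j' => a i' j'
                 | _, _ => (i == j)%:R
                 end.

Record gl := GL {
  gl_size : nat;
  gl_mx : 'M[B]_gl_size;
  gl_inv : mx_invertible gl_mx
}.

HB.instance Definition _ := gen_eqMixin gl.
HB.instance Definition _ := gen_choiceMixin gl.

Definition gl_equiv (u v : gl) : Prop :=
  exists N, [/\ (gl_size u <= N)%N, (gl_size v <= N)%N
    & gl_homotopic (stab N (gl_mx u)) (stab N (gl_mx v))].

Definition gl_rel : rel gl := fun u v => `[< gl_equiv u v >].

Lemma stab_lt n N (a : 'M[B]_n) (i j : 'I_N) (i' j' : 'I_n) :
  i = i' :> nat -> j = j' :> nat -> stab N a i j = a i' j'.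
Proof.
move=> ii jj; rewrite mxE /= ii jj.
by rewrite !insubT// => hi hj; congr (a _ _); exact: val_inj.
Qed.

Lemma stab_gel n N (a : 'M[B]_n) (i j : 'I_N) :
  (n <= i)%N -> stab N a i j = (i == j)%:R.
Proof. by move=> ni; rewrite mxE insubF// ltnNge ni. Qed.

Lemma stab_ger n N (a : 'M[B]_n) (i j : 'I_N) :
  (n <= j)%N -> stab N a i j = (i == j)%:R.
Proof.
by move=> nj; rewrite mxE; case: insub => // i'; rewrite insubF// ltnNge nj.
Qed.

Lemma stabM n N (a b : 'M[B]_n) : (n <= N)%N ->
  stab N (a *m b) = stab N a *m stab N b.
Proof.
move=> nN; apply/matrixP => i j; rewrite [RHS]mxE.
have [ni|lin] := leqP n i.
  rewrite stab_gel// (bigD1 i)//= big1 ?addr0 => [|k ki].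
    by rewrite !stab_gel// eqxx mul1r.
  by rewrite stab_gel// eq_sym (negPf ki) mul0r.
have [nj|ljn] := leqP n j.
  rewrite stab_ger// (bigD1 j)//= big1 ?addr0 => [|k kj].
    by rewrite !stab_ger// eqxx mulr1.
  by rewrite [stab N b _ _]stab_ger// (negPf kj) mulr0.
rewrite (@stab_lt _ _ _ i j (Ordinal lin) (Ordinal ljn))// mxE.
rewrite [RHS](bigID (fun k : 'I_N => (k < n)%N))/= [X in _ + X]big1 ?addr0.
  rewrite (reindex_onto (widen_ord nN)
    (fun k => match insub (val k) with Some k' => k' | None => Ordinal lin end)).
    apply: eq_big => [k|k _].
      rewrite /= ltn_ord/= insubT//= => hk.
      by apply/esym/eqP; exact: val_inj.
    by rewrite (@stab_lt _ _ a _ _ (Ordinal lin) k)// (@stab_lt _ _ b _ _ k (Ordinal ljn)).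
  by move=> k kn; rewrite insubT; exact: val_inj.
move=> k; rewrite -leqNgt => nk; rewrite stab_ger//.
have /negPf -> : i != k by rewrite neq_ltn (leq_trans lin nk).
by rewrite mul0r.
Qed.

Lemma stab1 n N : stab N (1%:M : 'M[B]_n) = 1%:M.
Proof.
apply/matrixP => i j; rewrite [RHS]mxE.
have [ni|lin] := leqP n i; first by rewrite stab_gel.
have [nj|ljn] := leqP n j; first by rewrite stab_ger.
by rewrite (@stab_lt _ _ _ i j (Ordinal lin) (Ordinal ljn))// mxE.
Qed.

Lemma stab_stab n m N (a : 'M[B]_n) : (n <= m)%N -> (m <= N)%N ->
  stab N (stab m a) = stab N a.
Proof.
move=> nm mN; apply/matrixP => i j.
have [mi|lim] := leqP m i; first by rewrite !stab_gel// (leq_trans nm).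
have [mj|ljm] := leqP m j; first by rewrite !stab_ger// (leq_trans nm).
rewrite (@stab_lt _ _ _ i j (Ordinal lim) (Ordinal ljm))//.
have [ni|lin] := leqP n i; first by rewrite !stab_gel.
have [nj|ljn] := leqP n j; first by rewrite !stab_ger.
rewrite (@stab_lt _ _ _ _ _ (Ordinal lin) (Ordinal ljn))//.
by rewrite (@stab_lt _ _ _ _ _ (Ordinal lin) (Ordinal ljn)).
Qed.

Lemma mx_invertible1 n : mx_invertible (1%:M : 'M[B]_n).
Proof. by exists 1%:M; rewrite mulmx1. Qed.

Lemma mx_invertibleM n (a b : 'M[B]_n) :
  mx_invertible a -> mx_invertible b -> mx_invertible (a *m b).
Proof.
move=> [a' [aa a'a]] [b' [bb b'b]]; exists (b' *m a').
by rewrite !mulmxA -(mulmxA a) bb mulmx1 aa -(mulmxA b') a'a mulmx1 b'b.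
Qed.

Lemma mx_invertible_stab n N (a : 'M[B]_n) : (n <= N)%N ->
  mx_invertible a -> mx_invertible (stab N a).
Proof.
by move=> nN [b [ab ba]]; exists (stab N b); rewrite -!stabM// ab ba stab1.
Qed.

Lemma homotopic_refl n (a : 'M[B]_n) : mx_invertible a -> gl_homotopic a a.
Proof. by move=> ia; exists (cst a); split=> // t; exact: cvg_cst. Qed.

Lemma homotopic_sym n (a b : 'M[B]_n) : gl_homotopic a b -> gl_homotopic b a.
Proof.
move=> [g [gc gi g0 g1]]; exists (fun t => g (1 - t)); split.
- move/subspace_continuousP in gc; apply/subspace_continuousP => t t01.
  have st01 x : `[0, 1]%classic x -> `[0, 1]%classic (1 - x : R).
    by rewrite /= !in_itv/= subr_ge0 gerBl andbC.
  have c1 : (fun x : R => 1 - x) @ t --> 1 - t.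
    by apply: cvgB; [exact: cvg_cst|exact: cvg_id].
  move=> U /(gc _ (st01 _ t01)) /c1 gU; rewrite /fmap/= /within/=.
  by apply: (@filterS _ (nbhs t) _ _ _ _ gU) => x /= gx /st01; exact: gx.
- by move=> t /andP[t0 t1]; apply: gi; rewrite subr_ge0 t1 gerBl t0.
- by rewrite subr0.
- by rewrite subrr.
Qed.

Lemma homotopic_mul n (a b c d : 'M[B]_n) :
  gl_homotopic a b -> gl_homotopic c d -> gl_homotopic (a *m c) (b *m d).
Proof.
move=> [g [gc gi g0 g1]] [h [hc hi h0 h1]].
exists (fun t => g t *m h t); split.
- by move=> t; apply: mx_cvgM; [exact: gc|exact: hc].
- by move=> t t01; exact: mx_invertibleM (gi _ t01) (hi _ t01).
- by rewrite g0 h0.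
- by rewrite g1 h1.
Qed.

Lemma homotopic_trans n (a b c : 'M[B]_n) :
  gl_homotopic a b -> gl_homotopic b c -> gl_homotopic a c.
Proof.
move=> ab bc.
have [b' [bb' b'b]] : mx_invertible b.
  by case: ab => g [_ gi _ <-]; apply: gi; rewrite ler01 lexx.
have ib' : mx_invertible b' by exists b.
have := homotopic_mul (homotopic_mul ab (homotopic_refl ib')) bc.
by rewrite -mulmxA b'b mulmx1 bb' mul1mx.
Qed.

Lemma homotopic_stab n N (a b : 'M[B]_n) : (n <= N)%N ->
  gl_homotopic a b -> gl_homotopic (stab N a) (stab N b).
Proof.
move=> nN [g [gc gi g0 g1]]; exists (fun t => stab N (g t)).
split; rewrite ?g0 ?g1//; last by move=> t /gi; exact: mx_invertible_stab.
move=> t; have /mx_cvgP gt := gc t.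
apply/mx_cvgP => i j.
rewrite (_ : (fun t => _) = (fun t => match insub (val i), insub (val j) with
  | Some i', Some j' => g t i' j' | _, _ => (i == j)%:R end)); last first.
  by apply/funext => s; rewrite mxE.
rewrite mxE; case: insub => [i'|]; last exact: cvg_cst.
by case: insub => [j'|]; [exact: gt|exact: cvg_cst].
Qed.

Lemma gl_equivS (u v : gl) : gl_equiv u v -> exists N0, forall N, (N0 <= N)%N ->
  [/\ (gl_size u <= N)%N, (gl_size v <= N)%N
    & gl_homotopic (stab N (gl_mx u)) (stab N (gl_mx v))].
Proof.
move=> [N0 [uN vN h]]; exists N0 => N N0N; split; [exact: leq_trans N0N..|].
by rewrite -(stab_stab _ uN N0N) -(stab_stab _ vN N0N); exact: homotopic_stab.
Qed.

Fact gl_rel_refl : reflexive gl_rel.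
Proof.
move=> u; apply/asboolP; exists (gl_size u); split=> //.
by apply: homotopic_refl; apply: mx_invertible_stab => //; exact: gl_inv.
Qed.

Lemma gl_equiv_sym u v : gl_equiv u v -> gl_equiv v u.
Proof. by move=> [N [uN vN h]]; exists N; split=> //; exact: homotopic_sym. Qed.

Fact gl_rel_sym : symmetric gl_rel.
Proof. by move=> u v; apply/asboolP/asboolP; exact: gl_equiv_sym. Qed.

Fact gl_rel_trans : transitive gl_rel.
Proof.
move=> v u w /asboolP/gl_equivS[N uv] /asboolP/gl_equivS[M vw]; apply/asboolP.
have [uN vN h] := uv _ (leq_maxl N M); have [_ wN k] := vw _ (leq_maxr N M).
by exists (maxn N M); split=> //; exact: homotopic_trans k.
Qed.

Canonical gl_equiv_rel := EquivRel gl_rel gl_rel_refl gl_rel_sym gl_rel_trans.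
Canonical gl_encModRel := defaultEncModRel gl_rel.

Definition gl_one : gl := GL (@mx_invertible1 0).

Fact gl_mul_inv (u v : gl) : let N := maxn (gl_size u) (gl_size v) in
  mx_invertible (stab N (gl_mx u) *m stab N (gl_mx v)).
Proof.
by apply: mx_invertibleM; apply: mx_invertible_stab;
  rewrite ?leq_maxl ?leq_maxr//; exact: gl_inv.
Qed.

Definition gl_mul (u v : gl) : gl := GL (gl_mul_inv u v).

Fact gl_Vmx (u : gl) : {b : 'M[B]_(gl_size u) |
  gl_mx u *m b = 1%:M /\ b *m gl_mx u = 1%:M}.
Proof. exact: cid (gl_inv u). Qed.

Fact gl_V_inv (u : gl) : mx_invertible (sval (gl_Vmx u)).
Proof. by case: gl_Vmx => b [ub bu]; exists (gl_mx u). Qed.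

Definition gl_V (u : gl) : gl := GL (gl_V_inv u).

(* K_1(B) = GL_oo(B) / GL_oo(B)_0, for B unital and complete: invertible
   matrices of all sizes, up to homotopy after stabilisation by identity blocks;
   the group law is matrix multiplication after stabilisation to a common
   size. *)
Definition K1 : Type := {eq_quot gl_rel}.

HB.instance Definition _ := Choice.on K1.
HB.instance Definition _ : EqQuotient gl gl_rel K1 := EqQuotient.on K1.

Definition K1cl (u : gl) : K1 := \pi_K1 u.

Lemma K1clP u v : K1cl u = K1cl v <-> gl_equiv u v.
Proof.
split=> [/eqP|/asboolP uv]; first by rewrite piE => /asboolP.
by apply/eqP; rewrite piE.
Qed.

Lemma reprK1K (p : K1) : K1cl (repr p) = p.
Proof. exact: reprK. Qed.

Lemma gl_mul_equiv u u' v v' :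
  gl_equiv u u' -> gl_equiv v v' -> gl_equiv (gl_mul u v) (gl_mul u' v').
Proof.
move=> /gl_equivS[N uu] /gl_equivS[M vv]; exists (maxn N M).
have [uN u'N h] := uu _ (leq_maxl N M); have [vN v'N k] := vv _ (leq_maxr N M).
rewrite /= !geq_max uN u'N vN v'N; split=> //.
rewrite !stabM ?geq_max ?uN ?u'N ?vN ?v'N//.
rewrite !stab_stab ?leq_maxl ?leq_maxr ?geq_max ?uN ?u'N ?vN ?v'N//.
exact: homotopic_mul.
Qed.

Definition K1one : K1 := K1cl gl_one.
Definition K1inv (p : K1) : K1 := K1cl (gl_V (repr p)).
Definition K1mul (p q : K1) : K1 := K1cl (gl_mul (repr p) (repr q)).

Lemma K1clM u v : K1cl (gl_mul u v) = K1mul (K1cl u) (K1cl v).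
Proof. by apply/K1clP/gl_mul_equiv; apply/K1clP; rewrite reprK1K. Qed.

Lemma K1cl_eq u v N : (gl_size u <= N)%N -> (gl_size v <= N)%N ->
  stab N (gl_mx u) = stab N (gl_mx v) -> K1cl u = K1cl v.
Proof.
move=> uN vN uv; apply/K1clP; exists N; split=> //; rewrite uv.
by apply: homotopic_refl; apply: mx_invertible_stab => //; exact: gl_inv.
Qed.

Lemma stab_mul u v N : (gl_size u <= N)%N -> (gl_size v <= N)%N ->
  stab N (gl_mx (gl_mul u v)) = stab N (gl_mx u) *m stab N (gl_mx v).
Proof.
move=> uN vN; rewrite /= stabM ?geq_max ?uN//.
by rewrite !stab_stab ?leq_maxl ?leq_maxr ?geq_max ?uN.
Qed.

Fact K1mulA : associative K1mul.
Proof.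
move=> p q r; rewrite -(reprK1K p) -(reprK1K q) -(reprK1K r) -!K1clM.
set u := repr p; set v := repr q; set w := repr r.
pose N := maxn (gl_size u) (maxn (gl_size v) (gl_size w)).
have uN : (gl_size u <= N)%N by rewrite leq_maxl.
have vN : (gl_size v <= N)%N by rewrite !leq_max leqnn !orbT.
have wN : (gl_size w <= N)%N by rewrite !leq_max leqnn !orbT.
have uvN : (gl_size (gl_mul u v) <= N)%N by rewrite geq_max uN.
have vwN : (gl_size (gl_mul v w) <= N)%N by rewrite geq_max vN.
apply: (@K1cl_eq _ _ N); [by rewrite geq_max uN|by rewrite geq_max uvN|].
by rewrite !stab_mul// mulmxA.
Qed.

Fact K1mul1 : left_id K1one K1mul.
Proof.
move=> p; rewrite -(reprK1K p) -K1clM; set u := repr p.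
apply: (@K1cl_eq _ _ (gl_size u)); rewrite ?geq_max ?leqnn//.
by rewrite stab_mul// stab1 mul1mx.
Qed.

Fact K1mulr1 : right_id K1one K1mul.
Proof.
move=> p; rewrite -(reprK1K p) -K1clM; set u := repr p.
apply: (@K1cl_eq _ _ (gl_size u)); rewrite ?geq_max ?leqnn//.
by rewrite stab_mul// stab1 mulmx1.
Qed.

Fact K1mulV : left_inverse K1one K1inv K1mul.
Proof.
move=> p; pose u := repr p.
have -> : K1mul (K1inv p) p = K1cl (gl_mul (gl_V u) u) by rewrite K1clM reprK1K.
apply: (@K1cl_eq _ _ (gl_size u)); rewrite ?geq_max ?leqnn//.
rewrite stab_mul//= -stabM// stab1.
by case: gl_Vmx => b [_ ub] /=; rewrite ub stab1.
Qed.

Fact K1mulrV : right_inverse K1one K1inv K1mul.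
Proof.
move=> p; pose u := repr p.
have -> : K1mul p (K1inv p) = K1cl (gl_mul u (gl_V u)) by rewrite K1clM reprK1K.
apply: (@K1cl_eq _ _ (gl_size u)); rewrite ?geq_max ?leqnn//.
rewrite stab_mul//= -stabM// stab1.
by case: gl_Vmx => b [ub _] /=; rewrite ub stab1.
Qed.

HB.instance Definition _ :=
  isGroup.Build K1 K1mulA K1mul1 K1mulr1 K1mulV K1mulrV.

End K1.

Record sub_zmod (G : zmodType) := SubZmod {
  sub_pred : G -> bool;
  sub_closed : zmod_closed sub_pred
}.

Definition sub_mem (G : zmodType) (H : sub_zmod G) : {pred G} := sub_pred H.

HB.instance Definition _ (G : zmodType) (H : sub_zmod G) :=
  GRing.isZmodClosed.Build G (sub_mem H) (sub_closed H).

HB.instance Definition _ (G : zmodType) := gen_eqMixin (sub_zmod G).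
HB.instance Definition _ (G : zmodType) := gen_choiceMixin (sub_zmod G).

(* The subspace topology of sub_zmod G in 2^G, with the product topology. *)
HB.instance Definition _ (G : zmodType) := Topological.copy (sub_zmod G)
  (initial_topology (@sub_pred G : sub_zmod G -> {ptws G -> bool})).

Definition sub_quot (G : zmodType) (H : sub_zmod G) : zmodType :=
  Quotient.quot (sub_mem H).

Definition Zinf : zmodType := {freeg nat / int}.

Definition borel_map (S T : topologicalType) (f : S -> T) : Prop :=
  forall U : set T, <<s open >> U -> <<s open >> (f @^-1` U).

(* The quotient carries the involution star (qpi a) = qpi (star a), so that the
   last clause says that phi preserves involutions. *)
Definition star_isomorphic_quot (R : realType) (A : cstarAlgType R)
    (K : closed_ideal A) (B : cstarAlgType R) : Prop :=
  exists phi : quot_alg K -> B,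
    [/\ bijective phi,
        {morph phi : x y / x + y},
        forall (c : R[i]) x, phi (c *: x) = c *: phi x,
        forall x y, phi (nalg_mul x y) = nalg_mul (phi x) (phi y)
      & forall a : A, phi (qpi K (star a)) = star (phi (qpi K a))].

(* B ranges over the unital separable C*-algebras: every quotient of the unital
   algebra A is unital, so no such A has all separable C*-algebras among its
   quotients. *)
Definition quotient_generator (R : realType) (A : cstarAlgType R) : Prop :=
  forall B : cstarAlgType R, separable_space B ->
    exists K : closed_ideal A, star_isomorphic_quot K B.

Definition zmod_group_isomorphic (G : zmodType) (H : groupType) : Prop :=
  exists f : G -> H, bijective f /\ (forall x y, f (x + y) = (f x * f y)%g).

(* Main.v *)
(** Fix a dense sequence in A and enumerate as [a_ k] the square matrices with
    entries in it.  Send the k-th generator of the free group to the class of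
    [a_ k] in K_1(A/K) when [a_ k] is invertible modulo K, and to the neutral
    element otherwise.  K_1 is abelian (Whitehead's lemma), and classes are
    locally constant on invertible matrices, so this defines a surjective
    homomorphism; kappa K is its kernel.

    For Borel measurability, the invertibility of a matrix modulo K is an open
    condition on K in the Wijsman topology, and so is the existence of a
    homotopy p ~ q modulo K: such a homotopy yields an invertible matrix g over
    A itself, homotopic to 1 over A, with q = g p modulo K, and this equality,
    relaxed to a strict inequality between distances to K, conversely gives the
    homotopy for all nearby ideals.  Completeness is thus only used in A, through
    the Neumann series of matrices close to 1. *)

Require Import Defs.
From HB Require Import structures.
From mathcomp Require Import all_boot all_order all_algebra ring_quotient.
From mathcomp Require Import complex all_classical reals topology normedtype.
From mathcomp Require Import sequences measurable_structure freeg.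

Set Implicit Arguments.
Unset Strict Implicit.
Unset Printing Implicit Defensive.

Import Order.TTheory GRing.Theory Num.Theory.
Import numFieldNormedType.Exports.

Local Open Scope classical_set_scope.
Local Open Scope ring_scope.
Local Open Scope complex_scope.
Local Open Scope quotient_scope.

(** * Paths of invertible matrices, and commutativity of K_1 *)

Section Matrix_homotopies.
Context (R : realType) (B : normedAlgType R).
Implicit Types (t : R).

(** The scaling [*:] of matrices over B takes its scalars in B, while segments need real ones. *)
Definition mxscale m n t (a : 'M[B]_(m, n)) : 'M[B]_(m, n) :=
  map_mx (fun x => t%:C *: x) a.

Lemma mxscale0 m n (a : 'M[B]_(m, n)) : mxscale 0 a = 0.
Proof. by apply/matrixP => i j; rewrite !mxE scale0r. Qed.

Lemma mxscale1 m n (a : 'M[B]_(m, n)) : mxscale 1 a = a.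
Proof. by apply/matrixP => i j; rewrite !mxE scale1r. Qed.

Lemma mxscaleAl m n p t (a : 'M[B]_(m, n)) (b : 'M[B]_(n, p)) :
  mxscale t a *m b = mxscale t (a *m b).
Proof.
apply/matrixP => i j; rewrite !mxE scaler_sumr; apply: eq_bigr => k _.
by rewrite mxE; apply/esym/nalg_scaleAl.
Qed.

Lemma mxscaleAr m n p t (a : 'M[B]_(m, n)) (b : 'M[B]_(n, p)) :
  a *m mxscale t b = mxscale t (a *m b).
Proof.
apply/matrixP => i j; rewrite !mxE scaler_sumr; apply: eq_bigr => k _.
by rewrite mxE; apply/esym/nalg_scaleAr.
Qed.

Lemma homotopic_segment n (z : 'M[B]_n) :
  (forall t, 0 <= t <= 1 -> mx_invertible (1%:M + mxscale t z)) ->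
  gl_homotopic 1%:M (1%:M + z).
Proof.
move=> zi; exists (fun t => 1%:M + mxscale t z).
split=> //; last 2 first.
- by rewrite mxscale0 addr0.
- by rewrite mxscale1.
apply: continuous_subspaceT => t; apply/mx_cvgP => i j.
rewrite (_ : (fun t => _) =
  (fun t => (1%:M : 'M[B]_n) i j + t%:C *: z i j)); last first.
  by apply/funext => s; rewrite !mxE.
rewrite !mxE; apply: cvgD; first exact: cvg_cst.
apply: cvgZr_tmp; apply/cvgrPdist_lt => e e0.
have e'0 : 0 < complex.Re e by move: e0; rewrite ltcE => /andP[].
have eE : e = (complex.Re e)%:C by rewrite RRe_real// gtr0_real.
near=> s; rewrite -rmorphB/= normc_def/= expr0n/= addr0 sqrtr_sqr eE ltcR.
near: s; exact: (@cvgr_dist_lt _ _ _ (nbhs t) _ id).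
Unshelve. all: by end_near. Qed.

(** The inverse of 1 + t z is 1 - t z. *)
Lemma homotopic_square0 n (z : 'M[B]_n) :
  z *m z = 0 -> gl_homotopic 1%:M (1%:M + z).
Proof.
move=> zz; apply: homotopic_segment => t _; exists (1%:M - mxscale t z).
have z0 : mxscale t z *m mxscale t z = 0.
  rewrite mxscaleAl mxscaleAr zz; apply/matrixP => i j.
  by rewrite !mxE !scaler0.
split; first by rewrite mulmxDl !mulmxBr !mul1mx mulmx1 z0 subr0 subrK.
by rewrite mulmxBl !mulmxDr !mul1mx mulmx1 z0 addr0 addrK.
Qed.

(** With b inverse to p r and c inverse to r p, the right inverse r b and the left inverse c r of p
    coincide. *)
Lemma mx_invertible_sandwich n (p r : 'M[B]_n) :
  mx_invertible (p *m r) -> mx_invertible (r *m p) -> mx_invertible p.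
Proof.
move=> [b [pb bp]] [c [rc cr]].
have e : c *m r = r *m b.
  by rewrite -[LHS]mulmx1 -pb !mulmxA -(mulmxA c) cr mul1mx.
by exists (r *m b); split; rewrite ?mulmxA// -e -mulmxA.
Qed.

Lemma homotopic_invertible n (a b : 'M[B]_n) : gl_homotopic a b -> mx_invertible b.
Proof. by move=> [c [_ ci _ <-]]; apply: ci; rewrite ler01 lexx. Qed.

(** Multiplying the reversed path from b to a by c on the left and d on the right gives a path from
    c b d = c to c a d = d. *)
Lemma homotopic_inv n (a b c d : 'M[B]_n) : gl_homotopic a b ->
  c *m a = 1%:M -> a *m c = 1%:M -> b *m d = 1%:M -> d *m b = 1%:M ->
  gl_homotopic c d.
Proof.
move=> ab ca ac bd db.
have ic : mx_invertible c by exists a.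
have id : mx_invertible d by exists b.
have := homotopic_mul (homotopic_mul (homotopic_refl ic) (homotopic_sym ab))
  (homotopic_refl id).
by rewrite ca mul1mx -mulmxA bd mulmx1.
Qed.

Lemma homotopic_elementary_u n (b : 'M[B]_n) :
  gl_homotopic 1%:M (block_mx 1%:M b 0 1%:M).
Proof.
have -> : block_mx 1%:M b 0 1%:M = 1%:M + block_mx 0 b 0 0.
  by rewrite scalar_mx_block add_block_mx !addr0 add0r.
by apply: homotopic_square0; rewrite mulmx_block !(mulmx0, mul0mx) addr0 block_mx0.
Qed.

Lemma homotopic_elementary_d n (b : 'M[B]_n) :
  gl_homotopic 1%:M (block_mx 1%:M 0 b 1%:M).
Proof.
have -> : block_mx 1%:M 0 b 1%:M = 1%:M + block_mx 0 0 b 0.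
  by rewrite scalar_mx_block add_block_mx !addr0 add0r.
by apply: homotopic_square0; rewrite mulmx_block !(mulmx0, mul0mx) addr0 block_mx0.
Qed.

(* The rotation by a right angle is a product of three elementary matrices, so
   that no trigonometric path is needed. *)
Lemma homotopic_rotation n (b : 'M[B]_n) : b *m b = 1%:M ->
  gl_homotopic 1%:M (block_mx 0 (- b) b 0).
Proof.
move=> bb.
have := homotopic_mul (homotopic_mul (homotopic_elementary_u (- b))
  (homotopic_elementary_d b)) (homotopic_elementary_u (- b)).
rewrite !mulmx1 !mulmx_block !(mulmx0, mul0mx, mulmx1, mul1mx, addr0, add0r).
by rewrite mulNmx bb subrr mul0mx sub0r mulmxN bb addNr.
Qed.

(** Conjugation by the rotation by a right angle exchanges the diagonal blocks; the rotation and its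
    inverse are both connected to 1. *)
Lemma homotopic_swap n (u : 'M[B]_n) : mx_invertible u ->
  gl_homotopic (block_mx u 0 0 1%:M) (block_mx 1%:M 0 0 u).
Proof.
move=> [v [uv vu]].
have iu : mx_invertible (block_mx u 0 0 (1%:M : 'M[B]_n)).
  exists (block_mx v 0 0 1%:M).
  rewrite !mulmx_block !(mulmx0, mul0mx, mulmx1, addr0, add0r).
  by rewrite uv vu -!scalar_mx_block.
have := homotopic_mul (homotopic_mul
  (homotopic_rotation (mulmx1 (1%:M : 'M[B]_n))) (homotopic_refl iu))
  (homotopic_rotation (_ : - (1%:M : 'M[B]_n) *m - 1%:M = 1%:M)).
rewrite opprK !mulmx_block.
rewrite !(mulmx0, mul0mx, mulmx1, mul1mx, addr0, add0r, mulNmx, mulmxN, oppr0).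
by rewrite !opprK; apply.
Qed.

Lemma stab_block n (u : 'M[B]_n) : stab (n + n) u = block_mx u 0 0 1%:M.
Proof.
apply/matrixP => i j; case: (split_ordP i) => i' ->; case: (split_ordP j) => j' ->.
- by rewrite block_mxEul; exact: stab_lt.
- by rewrite block_mxEur stab_ger /= ?leq_addr// mxE eq_lrshift.
- by rewrite block_mxEdl stab_gel /= ?leq_addr// mxE eq_rlshift.
- by rewrite block_mxEdr stab_gel /= ?leq_addr// mxE eq_rshift.
Qed.

(** Whitehead's lemma: diag(v, 1) is moved to diag(1, v), which commutes with diag(u, 1), and then
    moved back. *)
Lemma homotopic_stab_mulC n (u v : 'M[B]_n) :
  mx_invertible u -> mx_invertible v ->
  gl_homotopic (stab (n + n) (u *m v)) (stab (n + n) (v *m u)).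
Proof.
move=> iu iv; have nn : (n <= n + n)%N by exact: leq_addr.
rewrite !stabM// !stab_block.
have Ru : mx_invertible (block_mx u 0 0 (1%:M : 'M[B]_n)).
  by rewrite -stab_block; exact: mx_invertible_stab.
apply: (homotopic_trans (homotopic_mul (homotopic_refl Ru) (homotopic_swap iv))).
have -> : block_mx u 0 0 1%:M *m block_mx 1%:M 0 0 v =
          block_mx 1%:M 0 0 v *m block_mx u 0 0 1%:M.
  by rewrite !mulmx_block !(mulmx0, mul0mx, mulmx1, mul1mx, addr0, add0r).
by apply: homotopic_mul (homotopic_refl Ru); apply/homotopic_sym/homotopic_swap.
Qed.

Lemma K1mulC : commutative (@K1mul R B).
Proof.
move=> p q; rewrite -(reprK1K p) -(reprK1K q) -!K1clM.
set u := repr p; set v := repr q; pose n := maxn (gl_size u) (gl_size v).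
have un : (gl_size u <= n)%N by exact: leq_maxl.
have vn : (gl_size v <= n)%N by exact: leq_maxr.
have unn := leq_trans un (leq_addr n n); have vnn := leq_trans vn (leq_addr n n).
apply/K1clP; exists (n + n)%N; rewrite /= !geq_max unn vnn; split=> //.
have := homotopic_stab_mulC (mx_invertible_stab un (gl_inv u))
  (mx_invertible_stab vn (gl_inv v)).
by rewrite [maxn (gl_size v) _]maxnC.
Qed.

End Matrix_homotopies.

(** * Real-valued norms and small matrices *)

Section Rnorm.
Context (R : realType) (B : normedAlgType R).
Implicit Types x y : B.

Lemma rnorm0 : rnorm (0 : B) = 0.
Proof. by rewrite /rnorm normr0. Qed.

Lemma rnormN x : rnorm (- x) = rnorm x.
Proof. by rewrite /rnorm normrN. Qed.

Lemma rnormM x y : rnorm (x * y) <= rnorm x * rnorm y.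
Proof. by rewrite -lecR rmorphM/= !rnormE; exact: nalg_normM. Qed.

Lemma rnormZ (t : R) x : rnorm (t%:C *: x) = `|t| * rnorm x.
Proof.
apply: complexI; rewrite rnormE normrZ rmorphM/= rnormE; congr (_ * _).
by rewrite normc_def/= expr0n/= addr0 sqrtr_sqr.
Qed.

Lemma rnorm_sum I (r : seq I) (P : pred I) (F : I -> B) :
  rnorm (\sum_(i <- r | P i) F i) <= \sum_(i <- r | P i) rnorm (F i).
Proof.
elim/big_ind2 : _ => // [|a b c d h k]; first by rewrite rnorm0.
by apply: le_trans (rnormD _ _) _; exact: lerD.
Qed.

Lemma near_rnorm_lt (e : R) : 0 < e -> \forall x \near (0 : B), rnorm x < e.
Proof.
move=> e0; apply/nbhs_ballP; exists e%:C; first by rewrite /= ltcR.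
by move=> x; rewrite -ball_normE/= sub0r normrN -rnormE ltcR.
Qed.

Lemma cvg0_rnorm (T : Type) (F : set_system T) {FF : Filter F} (f : T -> B) :
  (forall e : R, 0 < e -> \forall t \near F, rnorm (f t) < e) -> f @ F --> 0.
Proof.
move=> fF; apply/cvgrPdist_lt => e e0.
have e'0 : 0 < complex.Re e by move: e0; rewrite ltcE => /andP[].
have eE : e = (complex.Re e)%:C by rewrite RRe_real// gtr0_real.
by apply: filterS (fF _ e'0) => t; rewrite sub0r normrN -rnormE eE ltcR.
Qed.

(** The bound makes the entries of the k-th power at most 2^-k for k > 0; n + 1 in place of n keeps
    it positive when n = 0. *)
Definition mxsmall n (x : 'M[B]_n) : Prop :=
  forall i j, rnorm (x i j) < (2 * n.+1%:R)^-1.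

Lemma near_mxsmall n : \forall x \near (0 : 'M[B]_n), mxsmall x.
Proof.
exists (fun _ _ => [set x | rnorm x < (2 * n.+1%:R)^-1]) => [i j|x xs i j].
  by rewrite mxE; apply: near_rnorm_lt; rewrite invr_gt0 mulr_gt0 ?ltr0n.
exact: xs.
Qed.

Lemma mxsmallZ n (t : R) (x : 'M[B]_n) : 0 <= t <= 1 ->
  mxsmall x -> mxsmall (mxscale t x).
Proof.
move=> /andP[t0 t1] xs i j; rewrite mxE rnormZ ger0_norm//.
by apply: le_lt_trans (xs i j); rewrite ler_piMl ?rnorm_ge0.
Qed.

End Rnorm.

(** * Neumann series of matrices *)

Section Neumann_series.
Context (R : realType) (A : normedAlgType R).
Context (complA : forall F : set_system A, ProperFilter F -> cauchy F -> cvg F).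

(** Exponents start at 1, because the unit of a normed algebra may have norm greater than 1. *)
Lemma mxsmallX n (x : 'M[A]_n) k i j : mxsmall x ->
  rnorm ((x ^+ k.+1) i j) <= 2^-1 ^+ k.+1.
Proof.
move=> xs; elim: k i j => [|k IHk] i j.
  rewrite !expr1; apply: le_trans (ltW (xs i j)) _.
  by rewrite lef_pV2 ?posrE ?mulr_gt0 ?ltr0n// ler_peMr// ler1n.
rewrite exprS mxE; apply: le_trans (rnorm_sum _ _ _) _.
apply: (@le_trans _ _ (\sum_(l < n) (2 * n.+1%:R)^-1 * 2^-1 ^+ k.+1)).
  apply: ler_sum => l _; apply: le_trans (rnormM _ _) _.
  by apply: ler_pM; rewrite ?rnorm_ge0// ?(ltW (xs _ _)).
rewrite sumr_const card_ord -[leLHS]mulr_natl mulrA [leRHS]exprS ler_wpM2r//.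
  by rewrite exprn_ge0// invr_ge0.
by rewrite invfM mulrCA ler_piMr ?invr_ge0// ler_pdivrMr ?ltr0n// mul1r ler_nat.
Qed.

Lemma cvg_geometric_mx n (x : 'M[A]_n) i j : mxsmall x ->
  cvgn (series (fun k => (x ^+ k) i j)).
Proof.
move=> xs; apply: complA; apply/cauchy_seriesP => e e0.
have e'0 : 0 < complex.Re e by move: e0; rewrite ltcE => /andP[].
have eE : e = (complex.Re e)%:C by rewrite RRe_real// gtr0_real.
have : cvgn (series (geometric 1 (2^-1 : R))).
  apply: is_cvg_geometric_series; rewrite ger0_norm ?invr_ge0//.
  by rewrite invf_lt1 ?ltr1n.
move=> /cauchy_cvgP/cauchy_seriesP/(_ _ e'0) gc.
(* The geometric bound covers positive exponents only, so the tails must avoid the index 0. *)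
have gt1 : \forall k \near (\oo, \oo), (0 < k.1)%N.
  exists ([set k | (0 < k)%N], setT); last by move=> [k l] [].
  by split; [exact: nbhs_infty_gt|exact: filterT].
apply: filterS2 gt1 gc => -[k l] /= k0.
rewrite eE -rnormE ltcR; apply: le_lt_trans.
apply: le_trans (rnorm_sum _ _ _) (le_trans _ (ler_norm _)).
rewrite !big_nat; apply: ler_sum => -[|m] /andP[km _]; first by case: k k0 km.
by rewrite mul1r; exact: mxsmallX.
Qed.

(** With y = -x, the partial sums satisfy (1 - y) S_m = 1 - y^m, and y^m tends to 0; their limit is
    the inverse. *)
Lemma mx_invertible_small n (x : 'M[A]_n) : mxsmall x -> mx_invertible (1%:M + x).
Proof.
move=> xs0; pose y : 'M[A]_n := - x.
have xs : mxsmall y by move=> i j; rewrite mxE rnormN.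
pose S m : 'M[A]_n := \sum_(k < m) y ^+ k.
pose L : 'M[A]_n := \matrix_(i, j) limn (series (fun k => (y ^+ k) i j)).
have SL : S @ \oo --> L.
  apply/mx_cvgP => i j; rewrite mxE.
  rewrite (_ : (fun m => _) = series (fun k => (y ^+ k) i j)).
    exact: cvg_geometric_mx.
  by apply/funext => m; rewrite summxE /series/= big_mkord.
have y0 : (fun m => 1%:M - y ^+ m : 'M[A]_n) @ \oo --> (1%:M : 'M[A]_n).
  apply/mx_cvgP => i j.
  rewrite (_ : (fun m => _) = (fun m => (1%:M : 'M[A]_n) i j - (y ^+ m) i j)).
    rewrite -[X in _ --> X]subr0; apply: cvgB; first exact: cvg_cst.
    rewrite -(@cvg_shiftS _ (fun m => (y ^+ m) i j)); apply: cvg0_rnorm => e e0.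
    have : (geometric (2^-1 : R) 2^-1) @ \oo --> (0 : R).
      by apply: cvg_geometric; rewrite ger0_norm ?invr_ge0// invf_lt1 ?ltr1n.
    move/cvgr_dist_lt => /(_ _ e0); apply: filterS => m.
    rewrite sub0r normrN; apply: le_lt_trans.
    apply: le_trans (ler_norm _); rewrite /= -exprS; exact: mxsmallX.
  by apply/funext => m; rewrite !mxE.
have xE : 1%:M + x = 1%:M - y by rewrite opprK.
have e1 m : (1%:M + x) *m S m = 1%:M - y ^+ m.
  by rewrite xE -opprB mulNmx [_ *m _](esym (subrX1 y m)) opprB.
have e2 m : S m *m (1%:M + x) = 1%:M - y ^+ m.
  (* S_m is a polynomial in y, so it commutes with 1 + x. *)
  rewrite -e1; suff /esym : GRing.comm (1%:M + x) (S m) by [].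
  apply: commr_sum => k _; apply: commrX; rewrite xE.
  by apply/commr_sym; apply: commrB; [exact: commr1|].
have uq (f : nat -> 'M[A]_n) (a b : 'M[A]_n) :
    f @ \oo --> a -> f @ \oo --> b -> a = b.
  move=> /mx_cvgP fa /mx_cvgP fb; apply/matrixP => i j.
  exact: (cvg_unique (@norm_hausdorff _ _)) (fa i j) (fb i j).
exists L; split.
- apply: uq y0; rewrite -(funext e1).
  by apply: mx_cvgM SL; exact: cvg_cst.
- apply: uq y0; rewrite -(funext e2).
  by apply: mx_cvgM; [exact: SL|exact: cvg_cst].
Qed.

Lemma homotopic_small n (x : 'M[A]_n) : mxsmall x -> gl_homotopic 1%:M (1%:M + x).
Proof.
by move=> xs; apply: homotopic_segment => t t01; exact/mx_invertible_small/mxsmallZ.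
Qed.

End Neumann_series.

(** * Matrices over A and over A/K *)

HB.instance Definition _ (R : realType) (A : normedAlgType R)
    (K : closed_ideal A) :=
  GRing.PzRing.copy (quot_alg K)
    (UnitalNormedAlgebra.sort (quot_alg K : normedAlgType R)).

Section Quotient_matrices.
Context (R : realType) (A : normedAlgType R) (K : closed_ideal A).

Definition qmx m n (a : 'M[A]_(m, n)) : 'M[quot_alg K]_(m, n) := map_mx (qpi K) a.

Lemma qpi_sum I (r : seq I) (P : pred I) (F : I -> A) :
  qpi K (\sum_(i <- r | P i) F i) = \sum_(i <- r | P i) qpi K (F i).
Proof. exact: (big_morph (qpi K) (@qpiD _ _ K) (qpi0 K)). Qed.

Lemma qpi_nat (b : bool) : qpi K b%:R = b%:R.
Proof. by case: b => //=; rewrite qpi0. Qed.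

Lemma qmxM m n p (a : 'M[A]_(m, n)) (b : 'M[A]_(n, p)) :
  qmx (a *m b) = qmx a *m qmx b.
Proof.
apply/matrixP => i j; rewrite !mxE qpi_sum; apply: eq_bigr => k _.
by rewrite !mxE qpiM.
Qed.

Lemma qmxD m n (a b : 'M[A]_(m, n)) : qmx (a + b) = qmx a + qmx b.
Proof. by apply/matrixP => i j; rewrite !mxE qpiD. Qed.

Lemma qmxB m n (a b : 'M[A]_(m, n)) : qmx (a - b) = qmx a - qmx b.
Proof. by apply/matrixP => i j; rewrite !mxE qpiD qpiN. Qed.

Lemma qmx1 n : qmx (1%:M : 'M[A]_n) = 1%:M.
Proof. by apply/matrixP => i j; rewrite !mxE qpi_nat. Qed.

Lemma qmx_stab n N (a : 'M[A]_n) : qmx (stab N a) = stab N (qmx a).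
Proof.
apply/matrixP => i j; rewrite !mxE.
case: insub => [i'|]; last exact: qpi_nat.
by case: insub => [j'|]; [rewrite mxE|exact: qpi_nat].
Qed.

Lemma qmx_surj m n (y : 'M[quot_alg K]_(m, n)) : exists x, qmx x = y.
Proof.
by exists (map_mx repr y); apply/matrixP => i j; rewrite !mxE reprqK.
Qed.

Lemma rnorm_qpi x : rnorm (qpi K x) = dist x K.
Proof. exact: qnormR_dist. Qed.

Lemma rnorm_qpi_le x : rnorm (qpi K x) <= rnorm x.
Proof. exact: qnormR_le. Qed.

(** Smallness is a strict bound on the quotient norm, an infimum, so some representative of each
    entry meets it too. *)
Lemma mxsmall_lift n (y : 'M[quot_alg K]_n) : mxsmall y ->
  exists2 x : 'M[A]_n, mxsmall x & qmx x = y.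
Proof.
move=> ys.
have lift i j : {x : A | rnorm x < (2 * n.+1%:R)^-1 /\ qpi K x = y i j}.
  apply: cid; have e0 : 0 < (2 * n.+1%:R)^-1 - rnorm (y i j) by rewrite subr_gt0.
  have [x xy] := qnormR_adh (y i j) e0.
  by rewrite -[qnormR _]/(rnorm (y i j)) addrC subrK => xs; exists x.
exists (\matrix_(i, j) sval (lift i j)) => [i j|].
  by rewrite mxE; case: (lift i j) => x [].
by apply/matrixP => i j; rewrite !mxE; case: (lift i j) => x [].
Qed.

Lemma qpi_continuous : continuous (qpi K).
Proof.
move=> x; apply/cvgrPdist_lt => e e0.
have e'0 : 0 < complex.Re e by move: e0; rewrite ltcE => /andP[].
have eE : e = (complex.Re e)%:C by rewrite RRe_real// gtr0_real.
near=> y; rewrite -qpiN -qpiD -rnormE eE ltcR.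
apply: le_lt_trans (rnorm_qpi_le _) _; rewrite -ltcR -eE rnormE.
near: y; exact: (@cvgr_dist_lt _ _ _ (nbhs x) _ id).
Unshelve. all: by end_near. Qed.

Lemma qmx_invertible n (a : 'M[A]_n) : mx_invertible a -> mx_invertible (qmx a).
Proof. by move=> [b [ab ba]]; exists (qmx b); rewrite -!qmxM ab ba qmx1. Qed.

Lemma qmx_homotopic n (a b : 'M[A]_n) :
  gl_homotopic a b -> gl_homotopic (qmx a) (qmx b).
Proof.
move=> [g [gc gi g0 g1]]; exists (fun t => qmx (g t)); split.
- move=> t; have /mx_cvgP gt := gc t; apply/mx_cvgP => i j.
  rewrite mxE (_ : (fun s => _) = (fun s => qpi K (g s i j))); last first.
    by apply/funext => s; rewrite mxE.
  by apply: cvg_comp (gt i j) _; exact: qpi_continuous.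
- by move=> t /gi; exact: qmx_invertible.
- by rewrite g0.
- by rewrite g1.
Qed.

End Quotient_matrices.

(** A locally constant property cuts [0, 1] into two relatively open pieces, and [0, 1] is
    connected. *)
Lemma unit_interval_propagate (R : realType) (P : set R) :
  (forall t : R, `[0, 1]%classic t ->
     \forall s \near within `[0, 1]%classic (nbhs t), P s <-> P t) ->
  P 0 -> P 1.
Proof.
move=> Ploc P0.
have i0 : `[0, 1]%classic (0 : R) by rewrite /= in_itv/= lexx ler01.
have i1 : `[0, 1]%classic (1 : R) by rewrite /= in_itv/= lexx ler01.
pose O (Q : set R) := interior [set s | `[0, 1]%classic s -> Q s].
have OE Q : (forall t : R, `[0, 1]%classic t ->
    \forall s \near within `[0, 1]%classic (nbhs t), Q s <-> Q t) ->
    `[0, 1]%classic `&` Q = `[0, 1]%classic `&` O Q.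
  move=> Qloc; apply/seteqP; split=> t [t01 Qt]; split=> //.
    by apply: (@filterS _ (nbhs t) _ _ _ _ (Qloc t t01)) => s h /h[_]; exact.
  by apply: (nbhs_singleton Qt).
have /seteqP[_ h] : `[0, 1]%classic `&` P = `[0, 1]%classic.
  apply: (@segment_connected R 0 1).
  - by exists 0.
  - by exists (O P); [exact: open_interior|exact: OE].
  - exists (~` O (~` P)); first exact/open_closedC/open_interior.
    have : `[0, 1]%classic `&` ~` P = `[0, 1]%classic `&` O (~` P).
      apply: OE => t /Ploc; apply: filterS => s PP.
      by split; apply: contra_not => ?; apply/PP.
    move=> e; apply/seteqP; split=> t [t01 Pt]; split=> //.
      by move=> Ot; have : (`[0, 1]%classic `&` O (~` P)) t by []; rewrite -e => -[].
    apply: contrapT => nP; apply: Pt.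
    by have : (`[0, 1]%classic `&` ~` P) t by []; rewrite e => -[].
by have [] := h 1 i1.
Qed.

(** * Lifting of homotopies from A/K to A *)

Section Lifting_homotopies.
Context (R : realType) (A : normedAlgType R).
Context (complA : forall F : set_system A, ProperFilter F -> cauchy F -> cvg F).
Context (K : closed_ideal A).

Lemma small_lift n (y : 'M[quot_alg K]_n) : mxsmall y ->
  exists2 g : 'M[A]_n, gl_homotopic 1%:M g & qmx K g = 1%:M + y.
Proof.
move=> /mxsmall_lift[x xs <-]; exists (1%:M + x); first exact: homotopic_small.
by rewrite qmxD qmx1.
Qed.

(** The Neumann series is summed in A on a lift of y, and the path found there projects to A/K. *)
Lemma quot_homotopic_small n (y : 'M[quot_alg K]_n) : mxsmall y ->
  gl_homotopic 1%:M (1%:M + y).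
Proof. by move=> /small_lift[g g1 <-]; rewrite -(qmx1 K); exact: qmx_homotopic. Qed.

(* The images of the g homotopic to 1 form a subgroup containing a neighbourhood
   of 1, so its cosets are open and a path cannot leave one. *)
Lemma homotopic_lift n (p q : 'M[quot_alg K]_n) : gl_homotopic p q ->
  exists2 g : 'M[A]_n, gl_homotopic 1%:M g & q = qmx K g *m p.
Proof.
move=> [c [cc ci c0 c1]].
pose P t := exists2 g : 'M[A]_n, gl_homotopic 1%:M g & c t = qmx K g *m p.
suff : P 1 by rewrite /P c1.
apply: unit_interval_propagate; last first.
  exists 1%:M; first by apply: homotopic_refl; exact: mx_invertible1.
  by rewrite c0 qmx1 mul1mx.
move=> t t01; have [d [cd dc]] := ci t t01.
(* As d inverts c(t), c(s) d is close to 1 for s near t; lifting it gives g homotopic to 1 with c(s)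
   = g c(t) modulo K. *)
have ct : (fun s => c s *m d - 1%:M) @ within `[0, 1]%classic (nbhs t) -->
    (0 : 'M[quot_alg K]_n).
  have /mx_cvgP h : (fun s => c s *m d) @ within `[0, 1]%classic (nbhs t) -->
      (1%:M : 'M[quot_alg K]_n).
    rewrite -cd; apply: mx_cvgM; last exact: cvg_cst.
    by move/subspace_continuousP : cc; exact.
  apply/mx_cvgP => i j.
  rewrite (_ : (fun s => _) =
    (fun s => (c s *m d) i j - (1%:M : 'M[quot_alg K]_n) i j)); last first.
    by apply/funext => s; rewrite [LHS]mxE [X in _ + X]mxE.
  have -> : (0 : 'M[quot_alg K]_n) i j =
      (1%:M : 'M[quot_alg K]_n) i j - (1%:M : 'M[quot_alg K]_n) i j.
    by rewrite [LHS]mxE subrr.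
  by apply: cvgB (h i j) _; exact: cvg_cst.
have cs0 : \forall s \near within `[0, 1]%classic (nbhs t),
    mxsmall (c s *m d - 1%:M) by exact: ct _ (near_mxsmall (quot_alg K) n).
apply: filterS cs0 => s cs0.
have [g g1] := small_lift cs0.
rewrite addrC subrK => gE.
have cs : c s = qmx K g *m c t by rewrite gE -mulmxA dc mulmx1.
have [g' [gg' g'g]] := homotopic_invertible g1.
(* Multiplying by the inverse of g passes from s to t, and by g from t to s. *)
split=> -[h h1 hE].
  exists (g' *m h); last first.
    by rewrite qmxM -mulmxA -hE cs mulmxA -qmxM g'g qmx1 mul1mx.
  rewrite -[1%:M]mulmx1; apply: homotopic_mul h1.
  by apply: homotopic_inv g1 _ _ _ _ => //; rewrite mulmx1.
exists (g *m h); last by rewrite cs hE mulmxA -qmxM.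
by rewrite -[1%:M]mulmx1; exact: homotopic_mul.
Qed.

End Lifting_homotopies.

(** * Borel sets of a topological space *)

Section Borel_sets.
Context (T : topologicalType).
Implicit Types X Y : set T.

Definition borel X : Prop := <<s open >> X.

Lemma open_borel X : open X -> borel X.
Proof. exact: sub_sigma_algebra. Qed.

Lemma borelC X : borel X -> borel (~` X).
Proof. by rewrite -setTD; exact: sigma_algebraCD. Qed.

Lemma borel_bigcup (F : nat -> set T) :
  (forall i, borel (F i)) -> borel (\bigcup_i F i).
Proof. exact: sigma_algebra_bigcup. Qed.

Lemma borel_exists (F : nat -> set T) :
  (forall i, borel (F i)) -> borel [set x | exists i, F i x].
Proof.
move=> Fb; rewrite (_ : mkset _ = \bigcup_i F i); first exact: borel_bigcup.
by apply/seteqP; split=> [x [i Fi]|x [i _ Fi]]; exists i.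
Qed.

Lemma borelU X Y : borel X -> borel Y -> borel (X `|` Y).
Proof.
move=> Xb Yb; rewrite (_ : _ `|` _ = \bigcup_i (if i is 0%N then X else Y)).
  by apply: borel_bigcup => -[].
apply/seteqP; split=> [x [Xx|Yx]|x [[|i] _ ?]]; [by exists 0%N|by exists 1%N|..].
- by left.
- by right.
Qed.

Lemma borelI X Y : borel X -> borel Y -> borel (X `&` Y).
Proof.
move=> /borelC Xb /borelC Yb; rewrite -[_ `&` _]setCK setCI; apply: borelC.
exact: borelU.
Qed.

Lemma borelT : borel setT.
Proof. by apply: open_borel; exact: openT. Qed.

End Borel_sets.

(** * Open conditions on an ideal in the Wijsman topology *)

Section Wijsman_openness.
Context (R : realType) (A : normedAlgType R).
Context (complA : forall F : set_system A, ProperFilter F -> cauchy F -> cvg F).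
Implicit Types K : closed_ideal A.

Lemma dist_continuous (x : A) : continuous (fun K : closed_ideal A => dist x K).
Proof.
move=> K; pose T := initial_topology (fun K : closed_ideal A => dist x K).
have KT : nbhs (K : closed_ideal A) --> (K : T).
  have [h _] := cvg_sup (fun x : A => Topological.class (initial_topology
    (fun K : closed_ideal A => dist x K))) K (nbhs_filter K).
  exact: h cvg_id x.
exact: cvg_trans (cvg_app _ KT) (@initial_continuous _ _ _ K).
Qed.

(** The norm of an entry modulo K is its distance to K, so smallness consists of finitely many
    strict inequalities on continuous functions of K. *)
Lemma near_mxsmall_quot n (m : 'M[A]_n) K0 : mxsmall (qmx K0 m) ->
  \forall K \near K0, mxsmall (qmx K m).
Proof.
move=> ms; pose e : R := (2 * n.+1%:R)^-1.
have h (ij : 'I_n * 'I_n) : \forall K \near K0, dist (m ij.1 ij.2) (ideal_set K) < e.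
  have := ms ij.1 ij.2; rewrite mxE rnorm_qpi => mlt.
  exact: cvgr_lt (@dist_continuous (m ij.1 ij.2) K0) _ mlt.
have : \forall K \near K0, forall ij : 'I_n * 'I_n,
    dist (m ij.1 ij.2) (ideal_set K) < e by exact (filter_forall (nbhs_filter K0) h).
apply: filterS => K Kh i j.
by rewrite mxE rnorm_qpi; exact: (Kh (i, j)).
Qed.

(** Equality modulo K need not be an open condition on K; its relaxation to a small difference
    is. *)
Lemma near_eq_quot n (m : 'M[A]_n) K0 : qmx K0 m = 1%:M ->
  \forall K \near K0, mxsmall (qmx K m - 1%:M).
Proof.
move=> m1; have : mxsmall (qmx K0 (m - 1%:M)).
  move=> i j; rewrite qmxB m1 qmx1 subrr mxE rnorm0.
  by rewrite invr_gt0 mulr_gt0 ?ltr0n.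
move=> /near_mxsmall_quot; apply: filterS => K.
by rewrite qmxB qmx1.
Qed.

(** For K near K0, p r and r p stay close to 1 modulo K, hence homotopic to 1 and invertible, which
    makes both factors invertible. *)
Lemma near_unit n (p r : 'M[A]_n) K0 : qmx K0 (p *m r) = 1%:M ->
  qmx K0 (r *m p) = 1%:M ->
  \forall K \near K0, [/\ mx_invertible (qmx K p), mx_invertible (qmx K r)
    & gl_homotopic 1%:M (qmx K (p *m r))].
Proof.
move=> /near_eq_quot pr /near_eq_quot rp; apply: filterS2 pr rp => K.
move=> /(quot_homotopic_small complA) + /(quot_homotopic_small complA).
rewrite ![1%:M + _]addrC !subrK !qmxM => pr rp.
have [ipr irp] := (homotopic_invertible pr, homotopic_invertible rp).
by split=> //; apply: mx_invertible_sandwich; eassumption.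
Qed.

Lemma near_invertible n (p : 'M[A]_n) K0 : mx_invertible (qmx K0 p) ->
  \forall K \near K0, mx_invertible (qmx K p).
Proof.
move=> [b []]; have [r <-] := qmx_surj b; rewrite -!qmxM => pr rp.
by apply: filterS (near_unit pr rp) => K [].
Qed.

(* The lift g does not depend on the ideal, so that q = g p up to a small error
   persists for the ideals near K0. *)
Lemma near_homotopic n (p q : 'M[A]_n) K0 :
  gl_homotopic (qmx K0 p) (qmx K0 q) ->
  \forall K \near K0, gl_homotopic (qmx K p) (qmx K q).
Proof.
move=> pq; have [g g1 qE] := homotopic_lift complA pq.
have [g' [gg' g'g]] := homotopic_invertible g1.
have [b []] := homotopic_invertible (homotopic_sym pq).
have [r <-] := qmx_surj b; rewrite -!qmxM => pr rp.
(* Modulo K0, q = g p, so q r g' = g (p r) g' = g g' = 1. *)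
have qrg : qmx K0 (q *m r *m g') = 1%:M.
  by rewrite qmxM qmxM qE -[_ *m qmx K0 r]mulmxA -qmxM pr mulmx1 -qmxM gg' qmx1.
apply: filterS2 (near_unit pr rp) (near_eq_quot qrg) => K [_ [r' [rr' r'r]] prK].
move=> /(quot_homotopic_small complA); rewrite addrC subrK => qrgK.
have ir' : mx_invertible r' by exists (qmx K r).
(* Modulo K, multiplying 1 ~ q r g' by 1 ~ g gives 1 ~ q r; as also 1 ~ p r, cancelling r leaves p ~
   q. *)
have := qmx_homotopic K g1; rewrite qmx1 => /(homotopic_mul qrgK).
rewrite mulmx1 -qmxM -mulmxA g'g mulmx1 => qrK.
have /homotopic_mul/(_ (homotopic_refl ir')) :=
  homotopic_trans (homotopic_sym prK) qrK.
by rewrite !qmxM -!mulmxA rr' !mulmx1.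
Qed.

Definition sqmx := {n : nat & 'M[A]_n}.

Definition inv_quot K (a : sqmx) : Prop := mx_invertible (qmx K (tagged a)).

Definition K1quot K (a : sqmx) : K1 (quot_alg K) :=
  if pselect (inv_quot K a) is left h then K1cl (GL h) else @K1one _ _.

Lemma K1quotE K a (h : inv_quot K a) : K1quot K a = K1cl (GL h).
Proof.
rewrite /K1quot; case: pselect => // h'; congr (K1cl (GL _)).
exact: Prop_irrelevance.
Qed.

(** The homotopy behind the relation lives at one fixed size N, so it persists near K0 together with
    the three invertibilities. *)
Lemma near_K1quotM (a b c : sqmx) K0 :
  inv_quot K0 a -> inv_quot K0 b -> inv_quot K0 c ->
  K1mul (K1quot K0 a) (K1quot K0 b) = K1quot K0 c ->
  \forall K \near K0, K1mul (K1quot K a) (K1quot K b) = K1quot K c.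
Proof.
move=> ia ib ic; rewrite !K1quotE -K1clM => /K1clP[N [abN cN]].
rewrite [gl_size _]/= in abN; rewrite [gl_size _]/= in cN.
rewrite /= -!qmx_stab -qmxM -!qmx_stab => /near_homotopic hN.
near=> K.
have ka : inv_quot K a by near: K; exact: near_invertible.
have kb : inv_quot K b by near: K; exact: near_invertible.
have kc : inv_quot K c by near: K; exact: near_invertible.
rewrite (K1quotE ka) (K1quotE kb) (K1quotE kc) -K1clM.
apply/K1clP; exists N; split=> //=; rewrite -!qmx_stab -qmxM -!qmx_stab.
by near: K; exact: hN.
Unshelve. all: by end_near. Qed.

End Wijsman_openness.

(** * Borel relations among the classes *)

Section Borel_K1_relations.
Context (R : realType) (A : normedAlgType R).
Context (complA : forall F : set_system A, ProperFilter F -> cauchy F -> cvg F).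
Implicit Types (K : closed_ideal A) (a b c : sqmx A).

(** The empty matrix is invertible modulo every ideal and represents the neutral class. *)
Definition unit_sqmx : sqmx A := existT _ 0%N 1%:M.

Lemma inv_unit_sqmx K : inv_quot K unit_sqmx.
Proof. by apply: qmx_invertible; exact: mx_invertible1. Qed.

Lemma K1quot_unit K : K1quot K unit_sqmx = @K1one _ _.
Proof.
rewrite (K1quotE (inv_unit_sqmx K)); apply: (@K1cl_eq _ _ _ _ 0) => //=.
by rewrite qmx1 stab1.
Qed.

Lemma K1quot_Ninv K a : ~ inv_quot K a -> K1quot K a = K1quot K unit_sqmx.
Proof. by move=> ia; rewrite K1quot_unit /K1quot; case: pselect. Qed.

Lemma borel_inv_quot a : borel [set K | inv_quot K a].
Proof. by apply: open_borel; rewrite openE => K; exact: near_invertible. Qed.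

(* Where a is not invertible modulo K, it may be replaced by the empty matrix. *)
Lemma borel_K1quot_class (F : sqmx A -> set (closed_ideal A)) :
  (forall K a b, K1quot K a = K1quot K b -> F a K -> F b K) ->
  (forall a, borel ([set K | inv_quot K a] `&` F a)) ->
  forall a, borel (F a).
Proof.
move=> Fext Fb a.
rewrite (_ : F a = ([set K | inv_quot K a] `&` F a) `|`
    (~` [set K | inv_quot K a] `&`
      ([set K | inv_quot K unit_sqmx] `&` F unit_sqmx))).
  by apply: borelU => //; apply: borelI => //; apply: borelC; exact: borel_inv_quot.
apply/seteqP; split=> [K Fa|K [[]//|[/K1quot_Ninv ia [_ F1]]]].
  have [ia|ia] := pselect (inv_quot K a); [by left|right].
  split=> //; split; first exact: inv_unit_sqmx.
  by apply: Fext Fa; exact: K1quot_Ninv.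
exact: Fext F1.
Qed.

Lemma borel_K1quotM a b c :
  borel [set K | K1mul (K1quot K a) (K1quot K b) = K1quot K c].
Proof.
(* Each of the three matrices in turn is reduced to the invertible case, where the relation is
   open. *)
move: a; apply: borel_K1quot_class => [K a a' /= ->//|a].
move: b; apply: borel_K1quot_class => [K b b' /= ->//|b].
move: c; apply: borel_K1quot_class => [K c c' /= ->//|c].
apply: open_borel; rewrite openE => K [/= ic [ib [ia abc]]].
near=> L; split; first by near: L; exact: near_invertible.
split; first by near: L; exact: near_invertible.
split; first by near: L; exact: near_invertible.
by near: L; exact: near_K1quotM.
Unshelve. all: by end_near. Qed.

End Borel_K1_relations.

(** * Representing all classes by a countable family *)

Section Dense_classes.
Context (R : realType) (A : normedAlgType R).
Context (complA : forall F : set_system A, ProperFilter F -> cauchy F -> cvg F).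

Lemma separable_dense_seq : separable_space A ->
  exists d : nat -> A, dense (range d).
Proof.
move=> [D /countable_injP[f] finj Dd].
(* f numbers the points of D; the sequence inverts f on its values and is 0 elsewhere. *)
exists (fun n => if pselect (exists2 x, D x & f x = n) is left h
  then s2val (cid2 h) else 0) => O O0 oO.
have [x [Ox Dx]] := Dd O O0 oO; exists x; split=> //; exists (f x) => //.
case: pselect => [h|[]]; last by exists x.
by case: cid2 => y /= Dy fyx; apply: finj => //; exact: mem_set.
Qed.

Context (d : nat -> A) (d_dense : dense (range d)).

(** [unpickle] runs through all square matrices of natural numbers, which serve as indices into d;
    numbers coding no matrix give the empty one. *)
Definition sqmx_seq (k : nat) : sqmx A :=
  if (unpickle k : option {n : nat & 'M[nat]_n}) is Some M
  then existT _ (tag M) (map_mx d (tagged M))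
  else unit_sqmx A.

Lemma dense_mx n (x : 'M[A]_n) (U : set 'M[A]_n) : nbhs x U ->
  exists M : 'M[nat]_n, U (map_mx d M).
Proof.
move=> [P xP PU].
have h i j : {k : nat | P i j (d k)}.
  apply: cid; have := xP i j; rewrite nbhsE => -[O [oO Ox] OP].
  have [y [/OP Py [k _ ky]]] := d_dense (ex_intro _ _ Ox) oO.
  by exists k; rewrite ky.
exists (\matrix_(i, j) sval (h i j)); apply: PU => i j.
by rewrite !mxE; exact: (svalP (h i j)).
Qed.

(** Let x and v lift an invertible y and its inverse w. A matrix m over the dense sequence close
    enough to x makes (m - x) v small, so modulo K m w is homotopic to 1, and m to y. *)
Lemma K1quot_surj (K : closed_ideal A) (z : K1 (quot_alg K)) :
  exists k, K1quot K (sqmx_seq k) = z.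
Proof.
rewrite -(reprK1K z); move: (repr z) => [n y iy].
have [w [yw wy]] := iy.
have [x xy] := qmx_surj y; have [v vw] := qmx_surj w.
have : (fun m => m *m v - x *m v) @ x --> (0 : 'M[A]_n).
  have /mx_cvgP h : (fun m => m *m v) @ x --> x *m v.
    by apply: (mx_cvgM (FF := nbhs_filter x)); [exact: cvg_id|exact: cvg_cst].
  apply/(mx_cvgP (FF := nbhs_filter x)) => i j.
  rewrite (_ : (fun s => _) = (fun s => (s *m v) i j - (x *m v) i j)); last first.
    by apply/funext => s; rewrite [LHS]mxE [X in _ + X]mxE.
  have -> : (0 : 'M[A]_n) i j = (x *m v) i j - (x *m v) i j.
    by rewrite [LHS]mxE subrr.
  by apply: cvgB (h i j) _; exact: cvg_cst.
move=> /(_ _ (near_mxsmall A n))/dense_mx[M /= Ms].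
set m := map_mx d M in Ms.
have mvs : mxsmall (qmx K m *m w - 1%:M).
  rewrite -yw -xy -vw -!qmxM -qmxB => i j; rewrite mxE.
  exact: le_lt_trans (rnorm_qpi_le _ _) (Ms i j).
have := quot_homotopic_small complA mvs; rewrite addrC subrK.
move=> /homotopic_mul/(_ (homotopic_refl iy)).
rewrite mul1mx -mulmxA wy mulmx1 => ym.
have im : inv_quot K (existT _ n m : sqmx A) by exact: homotopic_invertible ym.
exists (pickle (existT (fun n => 'M[nat]_n) n M)).
rewrite /sqmx_seq pickleK/= (K1quotE im); apply/K1clP; exists n; split=> //=.
by apply: homotopic_stab => //; exact: homotopic_sym.
Qed.

End Dense_classes.

(** * K_1 as an additive group, and homomorphisms from the free group *)

Section K1_zmodule.
Context (R : realType) (B : normedAlgType R).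

(** A copy of K_1 for the additive notation that commutativity permits; K_1 itself carries a
    multiplicative group structure. *)
Definition K1z : Type := K1 B.

HB.instance Definition _ := Choice.on K1z.
HB.instance Definition _ := GRing.isZmodule.Build K1z
  (@K1mulA R B) (@K1mulC R B) (@K1mul1 R B) (@K1mulV R B).

End K1_zmodule.

Section Free_lift.
Context (M : zmodType) (f : nat -> M).

Definition free_lift (x : Zinf) : M := fglift (f : nat -> zmodule M) x.

Lemma free_liftB : {morph free_lift : x y / x - y}.
Proof. exact: (lift_is_additive (f : nat -> zmodule M)). Qed.

Lemma free_lift0 : free_lift 0 = 0.
Proof. by have := free_liftB 0 0; rewrite !subrr. Qed.

Lemma free_liftD : {morph free_lift : x y / x + y}.
Proof.
move=> x y; rewrite -{1}[y]opprK free_liftB -[- y]sub0r free_liftB free_lift0.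
by rewrite sub0r opprK.
Qed.

Lemma free_lift_Freeg s : free_lift (Freeg s) = \sum_(x <- s) f x.2 *~ x.1.
Proof. by rewrite /free_lift fglift_Freeg. Qed.

End Free_lift.

(** * Countability of the free group, and Borel maps into the space of subgroups *)

Lemma Zinf_seq_surj : exists e : nat -> Zinf, forall x, exists k, e k = x.
Proof.
exists (fun k => if (unpickle k : option (seq (int * nat))) is Some s
  then Freeg s else 0) => x.
by exists (pickle (fgenum x)); rewrite pickleK; exact: Freeg_enum.
Qed.

(** Open sets of 2^G are countable unions of cylinders, and the preimage of a cylinder is a finite
    intersection of membership conditions and their complements. *)
Lemma borel_map_sub_zmod (S : topologicalType) (G : zmodType)
    (kappa : S -> sub_zmod G) (e : nat -> G) :
  (forall x, exists k, e k = x) ->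
  (forall x, borel [set s | sub_pred (kappa s) x]) -> borel_map kappa.
Proof.
move=> esurj kb.
have kb' x b : borel [set s | sub_pred (kappa s) x = b].
  case: b; first exact: kb.
  rewrite (_ : mkset _ = ~` [set s | sub_pred (kappa s) x]).
    by apply: borelC; exact: kb.
  by apply/seteqP; split=> s /=; [move=> ->|move/negP/negbTE].
pose cyl (c : seq (nat * bool)) : set (G -> bool) :=
  [set h | all (fun kb => h (e kb.1) == kb.2) c].
have cyl_borel c : borel [set s | cyl c (sub_pred (kappa s))].
  elim: c => [|[k b] c IHc].
    by rewrite (_ : mkset _ = setT); [exact: borelT|exact/seteqP].
  rewrite (_ : mkset _ = [set s | sub_pred (kappa s) (e k) = b] `&`
      [set s | cyl c (sub_pred (kappa s))]); first exact: borelI.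
  apply/seteqP; split=> s /=; [by move=> /andP[/eqP]|].
  by move=> [/eqP sk sc]; apply/andP.
pose cylk (i : nat) := cyl (odflt [::] (unpickle i)).
(* Cylinders are countably many, since G is countable. *)
have open_cyl (V : set {ptws G -> bool}) h : open V -> V h ->
    exists2 i, cylk i h & cylk i `<=` V.
  move=> oV Vh.
  (* F is generated by the cylinders through h; its pointwise convergence to h puts one of them
     inside V. *)
  pose F : set_system (G -> bool) := filter_from [set i | cylk i h] cylk.
  have FF : Filter F.
    apply: filter_from_filter.
      by exists (pickle ([::] : seq (nat * bool))); rewrite /= /cylk pickleK.
    move=> i j ih jh; pose u k : seq (nat * bool) := odflt [::] (unpickle k).
    exists (pickle (u i ++ u j)).
      by rewrite /= /cylk pickleK /cyl/= all_cat; apply/andP.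
    by move=> g; rewrite /= /cylk pickleK /cyl/= all_cat => /andP[].
  have : {ptws, F --> h}.
    apply/cvg_sup => x W [_ [[B _ <-] Bh BW]]; have [k kx] := esurj x.
    exists (pickle [:: (k, h x)]); rewrite /= /cylk pickleK /cyl/=.
      by rewrite kx eqxx.
    move=> g /=; rewrite andbT kx => /eqP gh; apply: BW.
    by rewrite /preimage/= /proj gh.
  by move=> /(_ V)[|i ih iV]; [exact: open_nbhs_nbhs|exists i].
(* The sets with Borel preimage form a sigma-algebra, so open sets suffice. *)
apply: smallest_sub => [|U [V oV VU]].
  have := sigma_algebra_image kappa (smallest_sigma_algebra setT (@open S)).
  by rewrite /image_set_system/=; under eq_fun do rewrite setTI.
rewrite -VU /=.
(* Cylinders not contained in V are replaced by the empty set, so that the union runs over all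
   natural numbers. *)
rewrite (_ : _ @^-1` _ = [set s | exists i,
    ((if pselect (cylk i `<=` V) then setT else set0) `&`
      [set s | cylk i (sub_pred (kappa s))]) s]).
  apply: borel_exists => i; apply: borelI; last exact: cyl_borel.
  case: pselect => h; first exact: borelT.
  by apply: open_borel; exact: open0.
apply/seteqP; split=> s /=.
  by move=> /(open_cyl _ _ oV)[i si iV]; exists i; case: pselect.
by move=> [i []]; case: pselect => // iV _ /iV.
Qed.

(** This turns x = 0 into an instance of x + y = z, the relation among classes known to be Borel. *)
Lemma addr_idem (M : zmodType) (x : M) : x + x = x <-> x = 0.
Proof.
by split=> [xx|->]; [apply: (addrI x); rewrite xx addr0|rewrite addr0].
Qed.

(** * The kernel map, its measurability and its quotients *)

Section Kernel_map.
Context (R : realType) (A : normedAlgType R).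
Context (complA : forall F : set_system A, ProperFilter F -> cauchy F -> cvg F).
Context (a_ : nat -> sqmx A).
Context (a_surj : forall (K : closed_ideal A) (z : K1 (quot_alg K)),
  exists k, K1quot K (a_ k) = z).

Definition class_seq (K : closed_ideal A) (k : nat) : K1z (quot_alg K) :=
  K1quot K (a_ k).

(* Every class is some class_seq K k, so the closure properties of this notion
   reduce, by countable unions, to the relations of class_seqD_borel. *)
Definition borel_section (s : forall K : closed_ideal A, K1z (quot_alg K)) :=
  forall k, borel [set K | s K = class_seq K k].

Lemma eq_borel_section s t : (forall K, s K = t K) ->
  borel_section t -> borel_section s.
Proof.
move=> st tb k; rewrite (_ : mkset _ = [set K | t K = class_seq K k])//.
by apply/seteqP; split=> K /=; rewrite st.
Qed.

Lemma class_seqD_borel i j k :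
  borel [set K | class_seq K i + class_seq K j = class_seq K k].
Proof. exact: borel_K1quotM. Qed.

Lemma class_seq_surj K (z : K1z (quot_alg K)) : exists k, class_seq K k = z.
Proof. exact: a_surj. Qed.

Lemma borel_section0 : borel_section (fun K => 0).
Proof.
move=> k; rewrite (_ : mkset _ =
  [set K | class_seq K k + class_seq K k = class_seq K k]).
  exact: class_seqD_borel.
by apply/seteqP; split=> K /= => [<-|/addr_idem ->//]; rewrite addr0.
Qed.

Lemma borel_sectionD s t : borel_section s -> borel_section t ->
  borel_section (fun K => s K + t K).
Proof.
move=> sb tb k; rewrite (_ : mkset _ = [set K | exists i, [set K | exists j,
  ([set K | s K = class_seq K i] `&` ([set K | t K = class_seq K j] `&`
   [set K | class_seq K i + class_seq K j = class_seq K k])) K] K]).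
  apply: borel_exists => i; apply: borel_exists => j.
  by apply: borelI => //; apply: borelI => //; exact: class_seqD_borel.
apply/seteqP; split=> K /= [].
  have [i iE] := class_seq_surj (s K); have [j jE] := class_seq_surj (t K).
  by move=> st; exists i, j; rewrite iE jE.
by move=> i [j [-> [-> ->]]].
Qed.

(** The equation -s = z is read as s + z = 0. *)
Lemma borel_sectionN s : borel_section s -> borel_section (fun K => - s K).
Proof.
move=> sb k; rewrite (_ : mkset _ = [set K | exists i, [set K | exists j,
  ([set K | s K = class_seq K i] `&` ([set K | 0 = class_seq K j] `&`
   [set K | class_seq K i + class_seq K k = class_seq K j])) K] K]).
  apply: borel_exists => i; apply: borel_exists => j.
  apply: borelI => //; apply: borelI; first exact: borel_section0.
  exact: class_seqD_borel.
apply/seteqP; split=> K /=.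
  have [i iE] := class_seq_surj (s K).
  have [j jE] := class_seq_surj (0 : K1z (quot_alg K)).
  by move=> st; exists i, j; rewrite iE jE -st subrr.
by move=> [i [j [-> [<- ik]]]]; apply/eqP; rewrite eq_sym -addr_eq0 addrC ik.
Qed.

Lemma borel_sectionMz s (m : int) : borel_section s ->
  borel_section (fun K => s K *~ m).
Proof.
move=> sb; have sn n : borel_section (fun K => s K *+ n).
  elim: n => [|n IHn]; first exact: borel_section0.
  by apply: eq_borel_section (borel_sectionD sb IHn) => K; rewrite mulrS.
by case: m => n; [exact: sn|exact: borel_sectionN (sn n.+1)].
Qed.

(** Equality of two classes is the addition relation with first term 0. *)
Lemma borel_section_class k : borel_section (fun K => class_seq K k).
Proof.
move=> l; rewrite (_ : mkset _ = [set K | exists j,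
  ([set K | 0 = class_seq K j] `&`
   [set K | class_seq K j + class_seq K k = class_seq K l]) K]).
  apply: borel_exists => j; apply: borelI; first exact: borel_section0.
  exact: class_seqD_borel.
apply/seteqP; split=> K /=.
  have [j jE] := class_seq_surj (0 : K1z (quot_alg K)).
  by move=> kl; exists j; rewrite jE add0r.
by move=> [j [<-]]; rewrite add0r.
Qed.

(** Each x is a finite integral combination of generators, so the closure properties apply by
    induction on its terms. *)
Lemma borel_section_lift x : borel_section (fun K => free_lift (class_seq K) x).
Proof.
rewrite -(Freeg_enum x).
apply: eq_borel_section (fun K => free_lift_Freeg (class_seq K) _) _.
elim: (fgenum x) => [|[m k] s IHs].
  by apply: eq_borel_section borel_section0 => K; rewrite big_nil.
have mk := borel_sectionMz m (borel_section_class k).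
by apply: eq_borel_section (borel_sectionD mk IHs) => K; rewrite big_cons.
Qed.

Lemma borel_lift0 x : borel [set K | free_lift (class_seq K) x = 0].
Proof.
rewrite (_ : mkset _ = [set K | exists j, ([set K | 0 = class_seq K j] `&`
   [set K | free_lift (class_seq K) x = class_seq K j]) K]).
  apply: borel_exists => j; apply: borelI; first exact: borel_section0.
  exact: borel_section_lift.
apply/seteqP; split=> K /=.
  have [j jE] := class_seq_surj (0 : K1z (quot_alg K)).
  by move=> kl; exists j; rewrite jE.
by move=> [j [<-]].
Qed.

Lemma kernel_zmod_closed K :
  zmod_closed (fun x : Zinf => `[< free_lift (class_seq K) x = 0 >]).
Proof.
split; first by apply/asboolP; exact: free_lift0.
move=> x y /asboolP x0 /asboolP y0; apply/asboolP.
by rewrite free_liftB x0 y0 subrr.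
Qed.

Definition kernel_map K : sub_zmod Zinf := SubZmod (kernel_zmod_closed K).

Lemma kernel_map_borel : borel_map kernel_map.
Proof.
have [e esurj] := Zinf_seq_surj; apply: (borel_map_sub_zmod esurj) => x.
rewrite (_ : mkset _ = [set K | free_lift (class_seq K) x = 0]).
  exact: borel_lift0.
by apply/seteqP; split=> K /asboolP.
Qed.

(** First isomorphism theorem; surjectivity holds because the generators already hit every class. *)
Lemma kernel_map_quotient K :
  zmod_group_isomorphic (sub_quot (kernel_map K)) (K1 (quot_alg K)).
Proof.
pose Q := sub_quot (kernel_map K); pose phi := free_lift (class_seq K).
have piP (x y : Zinf) : \pi_Q x = \pi_Q y <-> phi x = phi y.
  split=> [/eqP|xy].
    rewrite eqmodE => /asboolP.
    by rewrite free_liftB => /eqP; rewrite subr_eq0 => /eqP.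
  apply/eqP; rewrite eqmodE; apply/asboolP.
  by rewrite free_liftB; apply/eqP; rewrite subr_eq0; apply/eqP.
have phi_repr (x : Zinf) : phi (repr (\pi_Q x)) = phi x.
  by apply/piP; rewrite reprK.
have phi_surj z : exists x, phi x = z.
  have [k <-] := class_seq_surj z; exists (Freeg [:: (1, k)]).
  by rewrite /phi free_lift_Freeg big_seq1.
exists (fun q : Q => phi (repr q)); split.
  exists (fun z => \pi_Q (sval (cid (phi_surj z)))) => [q|z].
    by rewrite -[RHS]reprK; apply/piP; case: cid.
  by rewrite phi_repr; case: cid.
(* p + q is the class of the sum of the representatives, on which phi is additive. *)
move=> p q; rewrite -{1}[p]reprK -{1}[q]reprK.
rewrite -[X in phi (repr X)](@pi_addr _ _ _ _ _ (Quotient.quot _)).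
by rewrite phi_repr /phi free_liftD.
Qed.

End Kernel_map.

Theorem theorem8p9 (R : realType) (A : cstarAlgType R)
    (sepA : separable_space A) (genA : quotient_generator A) :
  exists kappa : closed_ideal A -> sub_zmod Zinf,
    borel_map kappa /\
    forall K : closed_ideal A,
      zmod_group_isomorphic (sub_quot (kappa K)) (K1 (quot_alg K)).
Proof.
have complA (F : set_system A) : ProperFilter F -> cauchy F -> cvg F.
  exact: cauchy_cvg.
have [d d_dense] := separable_dense_seq sepA.
have a_surj := K1quot_surj complA d_dense.
exists (kernel_map (sqmx_seq d)); split.
- exact: kernel_map_borel.
- exact: kernel_map_quotient.
Qed.
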